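(* A complex signal $o(t)$ constructed from an arbitrary complex signal $z(t)=z_r(t)+i\,z_i(t)$ using two classical Hilbert transforms operating independently on the real and imaginary parts, $$o(t)=\mathcal{H}[z_r(t)]-i\,\mathcal{H}[z_i(t)],$$ is orthogonal to $z(t)$, that is, $$\int_{-\infty}^{\infty} z(t)\,o^\star(t)\,\mathrm{d}t=0 .$$
   Context: $z_r(t)$ and $z_i(t)$ are the (real-valued) real and imaginary parts of $z(t)$. $\mathcal{H}[x(t)]$ denotes the classical Hilbert transform of a real signal $x(t)$, $\mathcal{H}[x(t)]=\mathrm{p.v.}\left(x*\frac{1}{\pi t}\right)$. The symbol $^\star$ denotes complex conjugation. Two complex signals $x(t)$ and $y(t)$ are called orthogonal if $\int_{-\infty}^{\infty}x(t)\,y^\star(t)\,\mathrm{d}t=0$.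
   Formalization: ''Arbitrary complex signal'' is taken to mean a finite-energy one (real and imaginary parts measurable and square-integrable); without this the claim fails, e.g. for z(t)=e^{it}, where the orthogonality integral diverges. *)

(* Defs.v *)
From HB Require Import structures.
From mathcomp Require Import all_boot all_order all_algebra.
From mathcomp Require Import complex.
From mathcomp Require Import all_classical all_reals all_analysis.

Set Implicit Arguments.
Unset Strict Implicit.
Unset Printing Implicit Defensive.

Import Order.TTheory GRing.Theory Num.Theory.
Import numFieldNormedType.Exports.

Local Open Scope classical_set_scope.
Local Open Scope ring_scope.
Local Open Scope complex_scope.

Notation Re_part z := (fun t => complex.Re (z t)) (only parsing).
Notation Im_part z := (fun t => complex.Im (z t)) (only parsing).

(* Signals have finite energy: both parts are measurable and
   square-integrable, i.e. \int |z|^2 < +oo. *)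
Definition finite_energy (R : realType) (z : R -> R[i]) : Prop :=
  Re_part z \in Lfun (@lebesgue_measure R) 2%:E /\
  Im_part z \in Lfun (@lebesgue_measure R) 2%:E.

Definition truncated_hilbert (R : realType) (eps : R) (x : R -> R) (t : R) : R :=
  (\int[@lebesgue_measure R]_(s in [set s | (eps < `|t - s|)%R])
     (x s * (1 / (pi * (t - s)))))%R.

(* The pointwise principal value of (x * 1/(pi t)) at t. For square-integrable
   x the truncated integrals converge absolutely, so no cut-off at infinity is
   needed, and the limit exists for almost every t; where it does not exist,
   [lim] returns a default value. *)
Definition hilbert (R : realType) (x : R -> R) (t : R) : R :=
  lim (truncated_hilbert eps x t @[eps --> 0^'+]).

Definition complex_integrable (R : realType) (f : R -> R[i]) : Prop :=
  (@lebesgue_measure R).-integrable setT (EFin \o Re_part f) /\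
  (@lebesgue_measure R).-integrable setT (EFin \o Im_part f).

Definition complex_integral (R : realType) (f : R -> R[i]) : R[i] :=
  (\int[@lebesgue_measure R]_t complex.Re (f t))%R +i*
  (\int[@lebesgue_measure R]_t complex.Im (f t))%R.

(* Integrability is required because [Rintegral] is 0 when the integral
   diverges. *)
Definition orthogonal_signals (R : realType) (x y : R -> R[i]) : Prop :=
  complex_integrable (fun t => x t * (y t)^*) /\
  complex_integral (fun t => x t * (y t)^*) = 0.

(* Main.v *)
(* Write p_y(u) = y / (u^2 + y^2) and q_y(u) = u / (u^2 + y^2), so that
   q_a * q_b = - pi p_(a+b) and p_a * q_b = pi q_(a+b) by partial fractions.
   For square-integrable f, all squared norms |l f + x (q_a * f) + y (q_b * f)|^2
   are then controlled by |f|^2 and by the values of the Poisson form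
   <p_c * f, f>, which tends to pi |f|^2 as c -> 0.  Hence q_y * f is Cauchy in
   L^2 as y -> 0; along a fast sequence of scales it converges almost everywhere
   to some h with |l f + h|^2 <= (l^2 + pi^2) |f|^2 for every real l, and this
   forces <f, h> = 0.  Moreover p_y * h = pi (q_y * f).  The truncated kernel
   1/u on |u| > e differs from q_e by an odd function bounded by p_e, so at the
   Lebesgue points of f and h the truncated Hilbert integrals converge to h.
   Thus <f, H f> = 0, and polarization makes H skew-symmetric, which is exactly
   the vanishing of the real and imaginary parts of the integral of z o^*. *)
Require Import Defs.
From HB Require Import structures.
From mathcomp Require Import all_boot all_order all_algebra.
From mathcomp Require Import complex.
From mathcomp Require Import all_classical all_reals all_analysis.
From mathcomp Require Import measurable_realfun ring lra.

Import Order.TTheory GRing.Theory Num.Theory.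
Import numFieldNormedType.Exports.

Local Open Scope classical_set_scope.
Local Open Scope ring_scope.
Local Open Scope complex_scope.

Set Implicit Arguments.
Unset Strict Implicit.
Unset Printing Implicit Defensive.

(** The L^2 bounds pass to the limit through Fatou's lemma, which keeps upper bounds only. The free
    multiple l f turns such a bound back into an equality: 2 l <f, h> stays bounded above for all l
    of both signs. The exact identities are first proved for f that is also integrable, where Fubini
    applies to f(s) f(s') times the kernels; truncation then reaches every square-integrable f.
    Convergence almost everywhere along one fast sequence says nothing about other scales. The
    relation between p_y * h and q_y * f closes this gap: the Poisson means of h converge at a
    Lebesgue point along all y -> 0, hence q_y * f does too. A separate obstacle is measurability.
    [hilbert] is a pointwise [lim] with a default value and the measurable sets are Borel, so
    equality almost everywhere with a measurable function is not enough; the set where the limit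
    exists has to be shown Borel. *)

Lemma cvg_EFin_comp (T : Type) (F : set_system T) {FF : Filter F} (R : realType)
  (u : T -> R) (l : R) : u @ F --> l -> (u t)%:E @[t --> F] --> l%:E.
Proof. by move=> ul; apply: cvg_EFin; first exact: nearW. Qed.

(** * Real-valued integrals: linearity, Fatou, dominated convergence *)

Section real_integrals.
Context d (T : measurableType d) (R : realType)
  (m : {measure set T -> \bar R}).
Implicit Types (f g : T -> R).

Definition integ f := m.-integrable [set: T] (EFin \o f).

Lemma integ_meas f : integ f -> measurable_fun [set: T] f.
Proof. by move=> /measurable_int /measurable_EFinP. Qed.

Lemma EFin_Rint f : integ f -> (\int[m]_t f t)%:E = (\int[m]_t (f t)%:E)%E.
Proof. by move=> h; rewrite /Rintegral fineK//; exact: integrable_fin_num. Qed.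

Lemma integ_le f g : measurable_fun [set: T] f -> integ g ->
  (forall t, `|f t| <= g t) -> integ f.
Proof.
move=> mf ig fg; apply: (le_integrable _ _ _ ig) => //.
  exact/measurable_EFinP.
by move=> t _ /=; rewrite lee_fin (le_trans (fg t))// ler_norm.
Qed.

Lemma integD f g : integ f -> integ g -> integ (fun t => f t + g t).
Proof.
move=> hf hg; have := integrableD measurableT hf hg.
by apply: eq_integrable.
Qed.

Lemma integZ (c : R) f : integ f -> integ (fun t => c * f t).
Proof.
move=> hf; have := integrableZl measurableT c hf.
by apply: eq_integrable.
Qed.

Lemma RintD f g : integ f -> integ g ->
  \int[m]_t (f t + g t) = \int[m]_t f t + \int[m]_t g t.
Proof. by move=> hf hg; rewrite -RintegralD. Qed.

Lemma RintZ (c : R) f : integ f -> \int[m]_t (c * f t) = c * \int[m]_t f t.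
Proof. by move=> hf; rewrite -RintegralZl. Qed.

Lemma Rint_le f g : integ f -> integ g -> (forall t, f t <= g t) ->
  \int[m]_t f t <= \int[m]_t g t.
Proof. by move=> hf hg fg; apply: le_Rintegral. Qed.

Lemma Rint_norm f : integ f -> `|\int[m]_t f t| <= \int[m]_t `|f t|.
Proof. by move=> hf; apply: le_normr_Rintegral. Qed.

Lemma integ_norm f : integ f -> integ (fun t => `|f t|).
Proof. by move=> hf; exact: integrable_norm. Qed.

Lemma ae_impl (P Q : T -> Prop) : (forall t, P t -> Q t) ->
  {ae m, forall t, P t} -> {ae m, forall t, Q t}.
Proof. by move=> PQ; apply: filterS. Qed.

Lemma ae_impl2 (P Q S : T -> Prop) : (forall t, P t -> Q t -> S t) ->
  {ae m, forall t, P t} -> {ae m, forall t, Q t} -> {ae m, forall t, S t}.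
Proof. by move=> PQ; apply: filterS2. Qed.

Lemma ae_Rint f g : integ f -> measurable_fun [set: T] g ->
  {ae m, forall t, f t = g t} ->
  integ g /\ \int[m]_t g t = \int[m]_t f t.
Proof.
move=> hf mg fg.
have mf := integ_meas hf.
have ae : ae_eq m [set: T] (EFin \o f) (EFin \o g).
  by apply: filterS fg => t /= ->.
split.
  apply/integrableP; split; first exact/measurable_EFinP.
  have /integrableP[_] := hf; apply: le_lt_trans.
  rewrite le_eqVlt; apply/orP; left; apply/eqP.
  apply: ae_eq_integral => //.
  - by apply: measurableT_comp => //; exact/measurable_EFinP.
  - by apply: measurableT_comp => //; exact/measurable_EFinP.
  - by apply: filterS fg => t /= ->.
rewrite /Rintegral; congr fine; apply: ae_eq_integral => //.
- exact/measurable_EFinP.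
- exact/measurable_EFinP.
- by apply: filterS fg => t /= ->.
Qed.

(** Integrability of the limit is part of the conclusion, so the lemma both creates
    square-integrable limits and bounds them. *)
Lemma real_fatou (f_ : nat -> T -> R) f (c : nat -> R) (l : R) :
  (forall n, integ (f_ n)) -> (forall n t, 0 <= f_ n t) ->
  measurable_fun [set: T] f ->
  {ae m, forall t, f_ n t @[n --> \oo] --> f t} ->
  (forall n, \int[m]_t f_ n t <= c n) -> c n @[n --> \oo] --> l ->
  integ f /\ \int[m]_t f t <= l.
Proof.
move=> If_ f0 mf cvf fc cl.
have mE n : measurable_fun [set: T] (EFin \o f_ n).
  by apply/measurable_EFinP; exact: integ_meas.
have ae1 : {ae m, forall t, [set: T] t ->
    `|f t|%:E = limn_einf (fun n => (f_ n t)%:E)}.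
  apply: filterS cvf => t cvt _.
  have ft0 : 0 <= f t.
    by apply: (cvgr_to_ge cvt); apply: nearW => n; exact: f0.
  rewrite ger0_norm//; apply/esym.
  by have [-> _] := cvg_limn_einf_sup (cvg_EFin_comp cvt).
have key : (\int[m]_t `|f t|%:E <= l%:E)%E.
  rewrite (ae_eq_integral (fun t => limn_einf (fun n => (f_ n t)%:E)))//; first last.
  - rewrite (_ : (fun t => _) =
      (fun t => - limn_esup (fun n => (- f_ n t)%:E))%E); last first.
      by apply/funext => t; rewrite -limn_einfN; congr (limn_einf _);
      apply/funext => n /=; rewrite opprK.
    apply: measurableT_comp => //; apply: measurable_fun_limn_esup => n.
    by apply/measurable_EFinP; apply: measurableT_comp => //; exact: integ_meas.
  - by apply/measurable_EFinP; exact: measurableT_comp.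
  apply: le_trans.
    by apply: (@fatou _ _ _ m _ measurableT (fun n t => (f_ n t)%:E)) => // n t _; rewrite lee_fin.
  have [<- _] := cvg_limn_einf_sup (cvg_EFin_comp cl).
  rewrite !limn_einf_lim; apply: lee_lim; [exact: is_cvg_einfs|exact: is_cvg_einfs|].
  apply: nearW => n; apply: le_ereal_inf_tmp => _ [k /= nk <-].
  rewrite (@le_trans _ _ (\int[m]_t (f_ k t)%:E)%E)//.
    by apply: ereal_inf_lbound; exists k.
  by rewrite -EFin_Rint// lee_fin.
have If : integ f.
  by apply/integrableP; split; [exact/measurable_EFinP|exact: le_lt_trans key (ltry _)].
split => //; rewrite -lee_fin EFin_Rint//; apply: le_trans key.
apply: le_integral => //; first exact: integ_norm.
by move=> t _; rewrite lee_fin ler_norm.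
Qed.

Lemma real_dct (f_ : nat -> T -> R) f g :
  (forall n, measurable_fun [set: T] (f_ n)) -> measurable_fun [set: T] f ->
  (forall t, f_ n t @[n --> \oo] --> f t) -> integ g ->
  (forall n t, `|f_ n t| <= g t) ->
  integ f /\ \int[m]_t f_ n t @[n --> \oo] --> \int[m]_t f t.
Proof.
move=> mf_ mf cvf ig fg.
have [] := @dominated_convergence _ T R m _ measurableT
  (fun n => EFin \o f_ n) (EFin \o f) (EFin \o g).
- by move=> n; exact/measurable_EFinP.
- exact/measurable_EFinP.
- by apply: nearW => t _; exact: cvg_EFin_comp.
- exact: ig.
- by apply: nearW => t n _; rewrite /= lee_fin.
move=> If _ Icvg.
split => //.
by move: Icvg; rewrite -EFin_Rint// => /fine_cvg.
Qed.

End real_integrals.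

(** * Fubini and Tonelli for real-valued integrands *)

Section real_fubini.
Context d1 d2 (T1 : measurableType d1) (T2 : measurableType d2) (R : realType).
Variables (m1 : {sigma_finite_measure set T1 -> \bar R})
  (m2 : {sigma_finite_measure set T2 -> \bar R}).
Implicit Types F : T1 * T2 -> R.

(** The positive and negative parts have measurable extended integrals by Tonelli; [fine] then takes
    care of the points where the integral is infinite. *)
Lemma measurable_Rint F : measurable_fun [set: T1 * T2] F ->
  measurable_fun [set: T1] (fun x => \int[m2]_y F (x, y)).
Proof.
move=> mF.
have mE : measurable_fun [set: T1 * T2] (EFin \o F) by exact/measurable_EFinP.
apply: measurableT_comp => //.
pose P x := (\int[m2]_y (EFin \o F)^\+ (x, y))%E.
pose N x := (\int[m2]_y (EFin \o F)^\- (x, y))%E.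
rewrite (_ : (fun _ => _) = (P \- N)%E); last first.
  apply/funext => x; rewrite integralE /P /N.
  by under eq_integral do rewrite (funepos_comp (EFin \o F) (fun y => (x, y)))/=;
  under [X in (_ - X)%E = _]eq_integral do
    rewrite (funeneg_comp (EFin \o F) (fun y => (x, y)))/=.
apply: emeasurable_funB.
- by apply: measurable_fun_fubini_tonelli_F => //; exact: measurable_funepos.
- by apply: measurable_fun_fubini_tonelli_F => //; exact: measurable_funeneg.
Qed.

Lemma measurable_Rint2 F : measurable_fun [set: T1 * T2] F ->
  measurable_fun [set: T2] (fun y => \int[m1]_x F (x, y)).
Proof.
move=> mF.
have mE : measurable_fun [set: T1 * T2] (EFin \o F) by exact/measurable_EFinP.
apply: measurableT_comp => //.
pose P y := (\int[m1]_x (EFin \o F)^\+ (x, y))%E.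
pose N y := (\int[m1]_x (EFin \o F)^\- (x, y))%E.
rewrite (_ : (fun _ => _) = (P \- N)%E); last first.
  apply/funext => y; rewrite integralE /P /N.
  by under eq_integral do rewrite (funepos_comp (EFin \o F) (fun x => (x, y)))/=;
  under [X in (_ - X)%E = _]eq_integral do
    rewrite (funeneg_comp (EFin \o F) (fun x => (x, y)))/=.
apply: emeasurable_funB.
- by apply: measurable_fun_fubini_tonelli_G => //; exact: measurable_funepos.
- by apply: measurable_fun_fubini_tonelli_G => //; exact: measurable_funeneg.
Qed.

Lemma prod_integ2 F (G : T2 -> R) : measurable_fun [set: T1 * T2] F ->
  (forall y, integ m1 (fun x => F (x, y))) ->
  integ m2 G -> (forall y, \int[m1]_x `|F (x, y)| <= G y) ->
  integ (m1 \x m2)%E F.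
Proof.
move=> mF IF IG FG; apply/(@integrable21ltyP _ _ _ _ _ m1 m2).
  exact/measurable_EFinP.
have /integrableP[_] := IG; apply: le_lt_trans.
apply: ge0_le_integral => //.
- by move=> x _; apply: integral_ge0.
- apply: (@measurable_fun_fubini_tonelli_G _ _ _ _ _ m1 (fun z => `|(F z)%:E|%E)) => //.
  by apply/measurable_EFinP; exact: measurableT_comp.
- apply: measurableT_comp => //; apply/measurable_EFinP.
  by apply/measurable_EFinP; exact: (measurable_int _ IG).
- move=> x _ /=; rewrite -EFin_Rint; last exact: integ_norm (IF x).
  by rewrite lee_fin (le_trans (FG x))// ler_norm.
Qed.

Lemma prod_integ F (G : T1 -> R) : measurable_fun [set: T1 * T2] F ->
  (forall x, integ m2 (fun y => F (x, y))) ->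
  integ m1 G -> (forall x, \int[m2]_y `|F (x, y)| <= G x) ->
  integ (m1 \x m2)%E F.
Proof.
move=> mF IF IG FG; apply/(@integrable12ltyP _ _ _ _ _ m1 m2).
  exact/measurable_EFinP.
have /integrableP[_] := IG; apply: le_lt_trans.
apply: ge0_le_integral => //.
- by move=> x _; apply: integral_ge0.
- apply: (@measurable_fun_fubini_tonelli_F _ _ _ _ _ m2 (fun z => `|(F z)%:E|%E)) => //.
  by apply/measurable_EFinP; exact: measurableT_comp.
- apply: measurableT_comp => //; apply/measurable_EFinP.
  by apply/measurable_EFinP; exact: (measurable_int _ IG).
- move=> x _ /=; rewrite -EFin_Rint; last exact: integ_norm (IF x).
  by rewrite lee_fin (le_trans (FG x))// ler_norm.
Qed.

Lemma fubini1 F : integ (m1 \x m2)%E F ->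
  integ m1 (fun x => \int[m2]_y F (x, y)) /\
  \int[m1]_x \int[m2]_y F (x, y) = \int[(m1 \x m2)%E]_z F z.
Proof.
move=> IF.
have ae1 := ae_integrable1 IF.
have IE := integrable_fubini_F IF.
(* Only almost everywhere: on sections that are not integrable the real integral may differ from the
   extended one. *)
have aeE : {ae m1, forall x, [set: T1] x ->
    (\int[m2]_y F (x, y))%:E = fubini_F m2 (EFin \o F) x}.
  by apply: filterS ae1 => x h _; rewrite EFin_Rint.
have mR : measurable_fun [set: T1] (fun x => \int[m2]_y F (x, y)).
  by apply: measurable_Rint; exact: integ_meas IF.
have mR' : measurable_fun [set: T1] (fun x => (\int[m2]_y F (x, y))%:E).
  exact/measurable_EFinP.
split.
  apply/integrableP; split => //.
  have /integrableP[mm] := IE; apply: le_lt_trans.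
  rewrite le_eqVlt; apply/orP; left; apply/eqP.
  apply: ae_eq_integral => //.
  - exact: measurableT_comp.
  - exact: measurableT_comp.
  - by apply: filterS aeE => x h Tx; congr abse; exact: h.
rewrite /Rintegral; congr fine; rewrite -(integral12_prod_meas1 IF).
apply: ae_eq_integral => //.
exact: measurable_int IE.
Qed.

Lemma fubini2 F : integ (m1 \x m2)%E F ->
  \int[m2]_y \int[m1]_x F (x, y) = \int[(m1 \x m2)%E]_z F z.
Proof.
move=> IF.
have ae1 := ae_integrable2 IF.
have aeE : {ae m2, forall y, [set: T2] y ->
    (\int[m1]_x F (x, y))%:E = fubini_G m1 (EFin \o F) y}.
  by apply: filterS ae1 => x h _; rewrite EFin_Rint.
have mR : measurable_fun [set: T2] (fun y => \int[m1]_x F (x, y)).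
  by apply: measurable_Rint2; exact: integ_meas IF.
have mR' : measurable_fun [set: T2] (fun y => (\int[m1]_x F (x, y))%:E).
  exact/measurable_EFinP.
rewrite /Rintegral; congr fine; rewrite -(integral21_prod_meas1 IF).
apply: ae_eq_integral => //.
exact: (measurable_fubini_G IF).
Qed.

End real_fubini.

(** * Sigma-finiteness of a product measure, for triple integrals *)

Section sigma_finite_product.
Context d1 d2 (T1 : measurableType d1) (T2 : measurableType d2) (R : realType).
Variables (m1 : {sigma_finite_measure set T1 -> \bar R})
  (m2 : {sigma_finite_measure set T2 -> \bar R}).

Lemma sigma_finite_product : sigma_finite [set: T1 * T2] (m1 \x m2)%E.
Proof.
have /sigma_finiteP[A [TA ndA finA]] := sigma_finiteT m1.
have /sigma_finiteP[B [TB ndB finB]] := sigma_finiteT m2.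
exists (fun n => A n `*` B n) => [|n].
  apply/seteqP; split=> [[x y] _|//].
  have [i _ Ax] : (\bigcup_n A n) x by rewrite -TA.
  have [j _ By] : (\bigcup_n B n) y by rewrite -TB.
  exists (maxn i j) => //; split => /=.
    by have /subsetPset := ndA _ _ (leq_maxl i j); exact.
  by have /subsetPset := ndB _ _ (leq_maxr i j); exact.
have [mA Ay] := finA n; have [mB By] := finB n.
split; first exact: measurableX.
by rewrite product_measure1E// lte_mul_pinfty// ge0_fin_numE.
Qed.

(* The canonical sigma-finite structure of the library on [m1 \x m2] is keyed on
   pairs of finite measures, so this one has to be given by hand. *)
Definition sigma_finite_prod : {sigma_finite_measure set (T1 * T2)%type -> \bar R} :=
  HB.pack (m1 \x m2)%E
    (Measure_isSigmaFinite.Build _ _ _ (m1 \x m2)%E sigma_finite_product).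

End sigma_finite_product.

(** * Improper integrals over the line from primitives *)

Section line_integrals.
Context (R : realType).
Local Notation mu := (@lebesgue_measure R).
Implicit Types (f g F : R -> R) (a b s t u : R).

(** A cut-off of the domain, not of the values. It exhausts the line for improper integrals, and it
    approximates a square-integrable signal by integrable ones. *)
Definition trunc (n : nat) f t := if `|t| <= n%:R then f t else 0.

Lemma trunc_le n f t : `|trunc n f t| <= `|f t|.
Proof. by rewrite /trunc; case: ifP => // _; rewrite normr0. Qed.

Lemma trunc_cvg f t : trunc n f t @[n --> \oo] --> f t.
Proof.
apply: cvg_near_cst; near=> n.
rewrite /trunc ifT//.
by near: n; exact: nbhs_infty_ger.
Unshelve. all: by end_near. Qed.

Lemma trunc_cvgS f t : trunc n.+1 f t @[n --> \oo] --> f t.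
Proof. by have := @trunc_cvg f t; rewrite -cvg_shiftS. Qed.

Lemma measurable_trunc n f : measurable_fun [set: R] f ->
  measurable_fun [set: R] (trunc n f).
Proof.
move=> mf; apply: measurable_fun_ifT => //.
apply: measurable_fun_ler => //.
Qed.

Lemma Rint_trunc n f :
  \int[mu]_t trunc n f t = \int[mu]_(t in `[- n%:R, n%:R]) f t.
Proof.
rewrite [RHS]Rintegral_mkcond; apply: eq_Rintegral => t _.
rewrite /trunc patchE ler_norml.
by rewrite mem_setE in_itv/=.
Qed.

(** The index [n.+1] keeps the segment nondegenerate, as the fundamental theorem on a segment
    requires. *)
Lemma FTC_trunc n f F : continuous f -> (forall u, is_derive u 1 F (f u)) ->
  \int[mu]_t trunc n.+1 f t = F n.+1%:R - F (- n.+1%:R).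
Proof.
move=> cf dF; rewrite Rint_trunc /Rintegral.
have cF u : F x @[x --> u] --> F u.
  apply: differentiable_continuous; apply/derivable1_diffP.
  by have [] := dF u.
rewrite (@continuous_FTC2 _ f F)//.
- by rewrite gtrN.
- exact: continuous_subspaceT.
- split.
  + by move=> u _; have [] := dF u.
  + by apply: cvg_at_right_filter; exact: cF.
  + by apply: cvg_at_left_filter; exact: cF.
- by move=> u _; rewrite derive1E; have [_ ->] := dF u.
Qed.

Lemma FTC_line f F (l : R) : continuous f ->
  (forall u, is_derive u 1 F (f u)) -> integ mu f ->
  F n.+1%:R - F (- n.+1%:R) @[n --> \oo] --> l ->
  \int[mu]_t f t = l.
Proof.
move=> cf dF If Fl.
have mf := continuous_measurable_fun cf.
have [_ Icvg] := @real_dct _ _ _ mu (fun n => trunc n.+1 f) f (fun t => `|f t|)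
  (fun n => measurable_trunc _ mf) mf
  (@trunc_cvgS f) (integ_norm If)
  (fun n t => trunc_le _ _ _).
move: Fl; under eq_fun do rewrite -(FTC_trunc _ cf dF).
by move=> Fl; exact: (cvg_unique _ Icvg Fl).
Qed.

Lemma integ_trunc_continuous n f : continuous f -> integ mu (trunc n f).
Proof.
move=> cf; rewrite /integ.
have -> : EFin \o trunc n f = (EFin \o f) \_ `[- n%:R, n%:R].
  apply/funext => t /=; rewrite /trunc patchE ler_norml.
  by rewrite mem_setE in_itv/=; case: ifP.
have : mu.-integrable `[- n%:R, n%:R] (EFin \o f).
  apply: continuous_compact_integrable; first exact: segment_compact.
  exact: continuous_subspaceT.
by move/integrable_mkcond; apply.
Qed.

(** For a nonnegative integrand, convergence of the increments of the primitive yields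
    integrability, by Fatou on the truncations. *)
Lemma FTC_line_ge0 f F (l : R) : continuous f -> (forall u, 0 <= f u) ->
  (forall u, is_derive u 1 F (f u)) ->
  F n.+1%:R - F (- n.+1%:R) @[n --> \oo] --> l -> integ mu f.
Proof.
move=> cf f0 dF Fl.
have mf := continuous_measurable_fun cf.
apply: (@real_fatou _ _ _ mu (fun n => trunc n.+1 f) f
  (fun n => F n.+1%:R - F (- n.+1%:R)) l _ _ mf _ _ Fl).1.
- by move=> n; exact: integ_trunc_continuous.
- by move=> n t; rewrite /trunc; case: ifP.
- by apply: nearW => t; exact: trunc_cvgS.
- by move=> n; rewrite (FTC_trunc _ cf dF).
Qed.

End line_integrals.

(** * The Poisson, conjugate Poisson and truncated Hilbert kernels *)

Section kernels.
Context (R : realType).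
Local Notation mu := (@lebesgue_measure R).
Implicit Types (a b s t u y e : R).

(* No factor [1 / pi]: these are [pi] times the usual Poisson, conjugate Poisson
   and truncated Hilbert kernels. *)
Definition poisson a u := a / (u ^+ 2 + a ^+ 2).
Definition cpoisson a u := u / (u ^+ 2 + a ^+ 2).
Definition hkernel e u := if e < `|u| then u^-1 else 0.

Lemma norm_mul_le (x y : R) : `|x * y| <= x ^+ 2 + y ^+ 2.
Proof. by rewrite ler_norml; apply/andP; split; nra. Qed.

Lemma den_gt0 a u : 0 < a -> 0 < u ^+ 2 + a ^+ 2.
Proof. by move=> a0; rewrite ltr_wpDl ?sqr_ge0// exprn_gt0. Qed.

Lemma poisson_gt0 a u : 0 < a -> 0 < poisson a u.
Proof. by move=> a0; rewrite divr_gt0// den_gt0. Qed.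

Lemma poisson_le a u : 0 < a -> poisson a u <= a^-1.
Proof.
move=> a0; rewrite /poisson ler_pdivrMr ?den_gt0//.
rewrite mulrC -ler_pdivrMr ?invr_gt0// invrK -expr2.
by rewrite lerDr sqr_ge0.
Qed.

(** From q_a^2 + p_a^2 = p_a / a. The square of either kernel thus lies below a multiple of the
    integrable Poisson kernel. *)
Lemma cpoisson_sqr_le a u : 0 < a -> cpoisson a u ^+ 2 <= a^-1 * poisson a u.
Proof.
move=> a0; have d0 := den_gt0 u a0.
have -> : a^-1 * poisson a u = (u ^+ 2 + a ^+ 2) / (u ^+ 2 + a ^+ 2) ^+ 2.
  by rewrite /poisson; field; rewrite !gt_eqF.
by rewrite /cpoisson exprMn exprVn ler_wpM2r ?invr_ge0 ?sqr_ge0// lerDl sqr_ge0.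
Qed.

Lemma poisson_sqr_le a u : 0 < a -> poisson a u ^+ 2 <= a^-1 * poisson a u.
Proof.
by move=> a0; rewrite expr2 ler_wpM2r ?poisson_le// ltW// poisson_gt0.
Qed.

Lemma cpoisson_le a u : 0 < a -> `|cpoisson a u| <= a^-1.
Proof.
move=> a0; rewrite -(@ler_pXn2r _ 2) ?nnegrE ?invr_ge0 ?(ltW a0)//.
rewrite real_normK ?num_real// (le_trans (cpoisson_sqr_le u a0))// expr2.
by rewrite ler_wpM2l ?poisson_le// invr_ge0 ltW.
Qed.

(** Provides the majorant for dominated convergence along scales that approach their limit from
    above. *)
Lemma cpoisson_anti a b u : 0 < a -> a <= b -> `|cpoisson b u| <= `|cpoisson a u|.
Proof.
move=> a0 ab; rewrite /cpoisson !normrM ler_wpM2l// ger0_norm ?invr_ge0; last first.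
  by rewrite ltW// den_gt0// (lt_le_trans a0).
rewrite ger0_norm ?invr_ge0 ?(ltW (den_gt0 _ a0))//.
rewrite lef_pV2 ?posrE ?den_gt0 ?(lt_le_trans a0)//.
by rewrite lerD2l lerXn2r ?nnegrE ?(ltW a0) ?(le_trans (ltW a0)).
Qed.

Lemma cpoissonN a u : cpoisson a (- u) = - cpoisson a u.
Proof. by rewrite /cpoisson sqrrN mulNr. Qed.

Lemma poissonN a u : poisson a (- u) = poisson a u.
Proof. by rewrite /poisson sqrrN. Qed.

Lemma hkernelN e u : hkernel e (- u) = - hkernel e u.
Proof. by rewrite /hkernel normrN; case: ifP; rewrite ?oppr0 ?invrN. Qed.

(** For |u| > e the difference is -p_e(u) e / u, and |e / u| < 1. For |u| <= e only q_e remains,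
    with |u| <= e in the numerator. *)
Lemma cpoisson_hkernel_le e u : 0 < e -> `|cpoisson e u - hkernel e u| <= poisson e u.
Proof.
move=> e0; have d0 := den_gt0 u e0; rewrite /hkernel; case: ltP => eu.
  have u0 : u != 0 by rewrite -normr_gt0 (lt_trans e0).
  have -> : cpoisson e u - u^-1 = - (poisson e u * (e / u)).
    by rewrite /cpoisson /poisson; field; rewrite u0 gt_eqF.
  rewrite normrN normrM (gtr0_norm (poisson_gt0 _ e0)) ger_pMr ?poisson_gt0//.
  rewrite normrM normfV (gtr0_norm e0) ler_pdivrMr ?normr_gt0//.
  by rewrite mul1r ltW.
rewrite subr0 /cpoisson /poisson normrM (gtr0_norm (x := _^-1)) ?invr_gt0//.
by rewrite ler_wpM2r// invr_ge0 ltW.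
Qed.

Lemma den_cont a : continuous (fun u : R => u ^+ 2 + a ^+ 2).
Proof.
by move=> u; apply: cvgD; [exact: exprn_continuous|exact: cvg_cst].
Qed.

Lemma poisson_cont a : 0 < a -> continuous (poisson a).
Proof.
move=> a0 u; apply: cvgM; first exact: cvg_cst.
by apply: cvgV; [rewrite gt_eqF// den_gt0|exact: den_cont].
Qed.

Lemma cpoisson_cont a : 0 < a -> continuous (cpoisson a).
Proof.
move=> a0 u; apply: cvgM; first exact: cvg_id.
by apply: cvgV; [rewrite gt_eqF// den_gt0|exact: den_cont].
Qed.

Lemma poisson_meas a : 0 < a -> measurable_fun [set: R] (poisson a).
Proof. by move=> a0; apply: continuous_measurable_fun; exact: poisson_cont. Qed.

Lemma cpoisson_meas a : 0 < a -> measurable_fun [set: R] (cpoisson a).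
Proof. by move=> a0; apply: continuous_measurable_fun; exact: cpoisson_cont. Qed.

Lemma hkernel_meas e : 0 < e -> measurable_fun [set: R] (hkernel e).
Proof.
move=> e0.
(* On |u| > e the maximum is u^2, so the branch is still 1 / u, but it is now given by a function
   continuous on the whole line. *)
rewrite (_ : hkernel e = (fun u => if e < `|u| then u * (Num.max (u ^+ 2) (e ^+ 2))^-1 else 0)).
  apply: measurable_fun_ifT => //; first exact: measurable_fun_ltr.
  apply: continuous_measurable_fun => u; apply: cvgM; first exact: cvg_id.
  apply: cvgV; first by rewrite gt_eqF// lt_max (exprn_gt0 2 e0) orbT.
  by apply: (@continuous_max _ _ (fun u : R => u ^+ 2) (cst (e ^+ 2)) u);
    [exact: exprn_continuous|exact: cvg_cst].
apply/funext => u; rewrite /hkernel; case: ltP => // eu.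
have u0 : u != 0 by rewrite -normr_gt0 (lt_trans e0).
rewrite max_l; first by field.
rewrite -(real_normK (num_real u)) ler_pXn2r// ?nnegrE// ltW//.
Qed.

Lemma shift_cont (f : R -> R) t : continuous f -> continuous (fun u => f (t - u)).
Proof.
move=> cf u; apply: (@continuous_comp _ _ _ (fun v => t - v) f); last exact: cf.
by apply: cvgB; [exact: cvg_cst|exact: cvg_id].
Qed.

Lemma cvg_atan_affine a c : 0 < a ->
  atan (a^-1 * (n.+1%:R + c)) @[n --> \oo] --> (pi / 2 : R).
Proof.
move=> a0; apply: cvg_comp (@cvgy_atan R).
apply/cvgryPge => A; near=> n.
rewrite mulrC ler_pdivlMr// -lerBlDr (@le_trans _ _ n%:R) ?ler_nat//.
by near: n; exact: nbhs_infty_ger.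
Unshelve. all: by end_near. Qed.

(** Subtracting 2 ln(n + 1) divides the quadratic by (n + 1)^2, and the quotient tends to 1. *)
Lemma cvg_ln_quad c d : 0 < d ->
  ln ((n.+1%:R + c) ^+ 2 + d ^+ 2) - 2 * ln (n.+1%:R) @[n --> \oo] --> (0 : R).
Proof.
move=> d0.
have h0 e : e * harmonic n @[n --> \oo] --> (e * 0 : R).
  by apply: cvgM; [exact: cvg_cst|exact: cvg_harmonic].
have h1 : 1 + c * harmonic n @[n --> \oo] --> (1 + c * 0 : R).
  by apply: cvgD; [exact: cvg_cst|exact: h0].
have h : (1 + c * harmonic n) * (1 + c * harmonic n) +
    (d * harmonic n) * (d * harmonic n) @[n --> \oo] --> (1 : R).
  rewrite [X in _ --> X](_ : _ = (1 + c * 0) * (1 + c * 0) + (d * 0) * (d * 0)).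
    by apply: cvgD; apply: cvgM.
  by ring.
have h2 : ln ((1 + c * harmonic n) * (1 + c * harmonic n) +
    (d * harmonic n) * (d * harmonic n)) @[n --> \oo] --> (ln 1 : R).
  by apply: (cvg_comp _ _ h); exact: continuous_ln.
rewrite ln1 in h2; move: h2; apply: cvg_trans; apply: near_eq_cvg.
apply: nearW => n /=; rewrite /harmonic.
have N0 : 0 < n.+1%:R :> R by rewrite ltr0n.
have -> : (1 + c * n.+1%:R^-1) * (1 + c * n.+1%:R^-1) +
    (d * n.+1%:R^-1) * (d * n.+1%:R^-1) =
  ((n.+1%:R + c) ^+ 2 + d ^+ 2) / n.+1%:R ^+ 2 :> R.
  by field; rewrite gt_eqF.
rewrite ln_div ?posrE ?den_gt0 ?exprn_gt0// lnXn// mulr_natl.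
by [].
Qed.

Lemma integ_poisson a t : 0 < a ->
  integ mu (fun u => poisson a (t - u)) /\ \int[mu]_u poisson a (t - u) = pi.
Proof.
move=> a0.
pose F u := atan (a^-1 * (u - t)).
have c := @shift_cont _ t (poisson_cont a0).
have dF u : is_derive u 1 F (poisson a (t - u)).
  have h : is_derive u 1 (a^-1 \*: (id - cst t)) (a^-1 *: (1 - 0)).
    exact: is_deriveZ.
  have h2 : is_derive u 1 F _ := is_derive1_comp (is_derive1_atan _) h.
  apply: (is_derive_eq h2).
  rewrite /poisson /= /GRing.scale/= [(id - cst t) u](_ : _ = u - t)//.
  have d1 := den_gt0 (t - u) a0.
  have d2 : 0 < a ^+ 2 + (u - t) ^+ 2 by rewrite addrC den_gt0.
  by field; rewrite !gt_eqF.
have lF : F n.+1%:R - F (- n.+1%:R) @[n --> \oo] --> (pi : R).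
  rewrite (_ : (fun _ => _) = (fun n => atan (a^-1 * (n.+1%:R - t)) +
     atan (a^-1 * (n.+1%:R + t)))); last first.
    apply/funext => n; rewrite /F -atanN; congr (_ + atan _); ring.
  rewrite [X in _ --> X]splitr; apply: cvgD.
  - exact: cvg_atan_affine.
  - exact: cvg_atan_affine.
have If := FTC_line_ge0 c (fun u => ltW (poisson_gt0 _ a0)) dF lF.
by split => //; exact: (FTC_line c dF If lF).
Qed.

(** Each conjugate kernel decays only like 1 / u and is not integrable, but in this sum the leading
    terms cancel because x + w = t - s is constant: q_a(x) + q_b(w) = (x + w) q_a(x) q_b(w) + b
    q_a(x) p_b(w) + a p_a(x) q_b(w). Every product on the right is bounded by squares of kernels,
    hence by Poisson kernels. *)
Lemma sum_cpoisson_le a b s t u : 0 < a -> 0 < b ->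
  `|cpoisson a (t - u) + cpoisson b (u - s)| <=
    (`|t - s| * (a^-1 + b^-1) + (b / a + 1) + (a / b + 1)) *
    (poisson a (t - u) + poisson b (u - s)).
Proof.
move=> a0 b0.
set x := t - u; set w := u - s.
have -> : t - s = x + w by rewrite /x /w; ring.
have da := den_gt0 x a0; have db := den_gt0 w b0.
have -> : cpoisson a x + cpoisson b w = (x + w) * (cpoisson a x * cpoisson b w) +
   b * (cpoisson a x * poisson b w) + a * (poisson a x * cpoisson b w).
  by rewrite /cpoisson /poisson; field; rewrite !gt_eqF.
have am := norm_mul_le.
have pa := poisson_gt0 x a0; have pb := poisson_gt0 w b0.
have qa2 := cpoisson_sqr_le x a0; have qb2 := cpoisson_sqr_le w b0.
have pa2 := poisson_sqr_le x a0; have pb2 := poisson_sqr_le w b0.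
have ia : 0 < a^-1 by rewrite invr_gt0.
have ib : 0 < b^-1 by rewrite invr_gt0.
have eab : b / a * a^-1 * a = b / a by field; rewrite gt_eqF.
apply: (le_trans (ler_normD _ _)).
apply: (@le_trans _ _ (`|x + w| * ((a^-1 + b^-1) * (poisson a x + poisson b w)) +
   (b / a + 1) * (poisson a x + poisson b w) +
   (a / b + 1) * (poisson a x + poisson b w))); last first.
  by rewrite le_eqVlt; apply/orP; left; apply/eqP; ring.
apply: lerD; first (apply: (le_trans (ler_normD _ _)); apply: lerD).
- rewrite normrM ler_wpM2l//; apply: (le_trans (am _ _)); nra.
- rewrite normrM (gtr0_norm b0).
  apply: (@le_trans _ _ (b * (a^-1 * poisson a x + b^-1 * poisson b w))).
    rewrite ler_wpM2l ?(ltW b0)//; apply: (le_trans (am _ _)); nra.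
  rewrite mulrDr 2!(mulrA b) mulfV ?gt_eqF//.
  have : 0 < b / a * poisson b w by rewrite mulr_gt0// divr_gt0.
  move=> h; rewrite -subr_ge0 [leRHS](_ : _ = poisson a x + b / a * poisson b w); last by ring.
  by rewrite addr_ge0// ltW.
- rewrite normrM (gtr0_norm a0).
  apply: (@le_trans _ _ (a * (a^-1 * poisson a x + b^-1 * poisson b w))).
    rewrite ler_wpM2l ?(ltW a0)//; apply: (le_trans (am _ _)); nra.
  rewrite mulrDr 2!(mulrA a) mulfV ?gt_eqF//.
  have : 0 < a / b * poisson a x by rewrite mulr_gt0// divr_gt0.
  move=> h; rewrite -subr_ge0 [leRHS](_ : _ = poisson b w + a / b * poisson a x); last by ring.
  by rewrite addr_ge0// ltW.
Qed.

Lemma integ_poisson' b s : 0 < b -> integ mu (fun u => poisson b (u - s)) /\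
  \int[mu]_u poisson b (u - s) = pi.
Proof.
move=> b0.
have e : (fun u => poisson b (u - s)) = (fun u => poisson b (s - u)).
  by apply/funext => u; rewrite -poissonN opprB.
by rewrite e; exact: integ_poisson.
Qed.

Lemma is_derive_ln_quad u c d : 0 < d ->
  is_derive u 1 (fun v => ln ((v + c) ^+ 2 + d ^+ 2))
    (2 * (u + c) / ((u + c) ^+ 2 + d ^+ 2)).
Proof.
move=> d0.
have h : is_derive u (1 : R) ((id + cst c) ^+ 2 + cst (d ^+ 2)) _ :=
  is_deriveD (is_deriveX 2 (is_deriveD (is_derive_id u 1) (is_derive_cst c u 1)))
    (is_derive_cst _ _ _).
have h2 : is_derive u 1 (fun v => ln ((v + c) ^+ 2 + d ^+ 2)) _ :=
  @is_derive1_comp R (@ln R) ((id + cst c) ^+ 2 + cst (d ^+ 2)) u _ _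
    (is_derive1_ln (den_gt0 (u + c) d0)) h.
apply: (is_derive_eq h2); rewrite /GRing.scale/= [(id + cst c) u](_ : _ = u + c)//.
by field; rewrite gt_eqF ?den_gt0.
Qed.

Lemma integ_sum_cpoisson a b s t : 0 < a -> 0 < b ->
  integ mu (fun u => cpoisson a (t - u) + cpoisson b (u - s)) /\
  \int[mu]_u (cpoisson a (t - u) + cpoisson b (u - s)) = 0.
Proof.
move=> a0 b0.
have c : continuous (fun u => cpoisson a (t - u) + cpoisson b (u - s)).
  move=> u; apply: cvgD; first exact: (@shift_cont _ t (cpoisson_cont a0)).
  apply: (@continuous_comp _ _ _ (fun v => v - s) (cpoisson b)); last exact: cpoisson_cont.
  by apply: cvgB; [exact: cvg_id|exact: cvg_cst].
have I : integ mu (fun u => cpoisson a (t - u) + cpoisson b (u - s)).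
  have h := integZ (`|t - s| * (a^-1 + b^-1) + (b / a + 1) + (a / b + 1))
    (integD (integ_poisson t a0).1 (integ_poisson' s b0).1).
  apply: (integ_le _ h); first exact: continuous_measurable_fun.
  by move=> u; exact: sum_cpoisson_le.
split => //.
pose L k d (u : R) := ln ((u + k) ^+ 2 + d ^+ 2).
have LN k d u : L k d (- u) = L (- k) d u.
  by rewrite /L -(sqrrN (- u + k)) opprD opprK.
(* Both logarithms grow at the same rate, so this primitive vanishes at both ends. *)
pose F u := 2^-1 * (L (- s) b u - L (- t) a u).
apply: (@FTC_line _ _ F) => //.
  move=> u.
  have h : is_derive u 1 (2^-1 \*: (L (- s) b - L (- t) a)) _ :=
    is_deriveZ _ (is_deriveB (is_derive_ln_quad u (- s) b0)
      (is_derive_ln_quad u (- t) a0)).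
  apply: (is_derive_eq h); rewrite /GRing.scale/= /cpoisson.
  have d1 := den_gt0 (t - u) a0; have d2 := den_gt0 (u - s) b0.
  have d3 : 0 < (u - t) ^+ 2 + a ^+ 2 by exact: den_gt0.
  by field; rewrite !gt_eqF.
rewrite (_ : (fun _ => _) = (fun n =>
   2^-1 * ((L (- s) b n.+1%:R - 2 * ln n.+1%:R) -
           (L (- t) a n.+1%:R - 2 * ln n.+1%:R) -
           (L s b n.+1%:R - 2 * ln n.+1%:R) +
           (L t a n.+1%:R - 2 * ln n.+1%:R)))); last first.
  by apply/funext => n; rewrite /F !LN !opprK; field.
rewrite [X in _ --> X](_ : _ = 2^-1 * (0 - 0 - 0 + 0) :> R); last by ring.
apply: cvgM; first exact: cvg_cst.
by apply: cvgD; [apply: cvgB; [apply: cvgB|]|]; exact: cvg_ln_quad.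
Qed.

(* The two convolution identities come from the partial fraction decomposition
   of [cpoisson a x * cpoisson b w] and [poisson a x * cpoisson b w] in [x], with
   [x + w] fixed; it degenerates only at [x + w = 0] and [a = b]. *)
Lemma conv_kernels_nondegenerate a b s t : 0 < a -> 0 < b ->
  (t - s != 0) || (a != b) ->
  \int[mu]_u (cpoisson a (t - u) * cpoisson b (u - s)) = - pi * poisson (a + b) (t - s) /\
  \int[mu]_u (poisson a (t - u) * cpoisson b (u - s)) = pi * cpoisson (a + b) (t - s).
Proof.
move=> a0 b0 nd.
set r := t - s in nd *.
have D1 : 0 < r ^+ 2 + (a + b) ^+ 2 by rewrite den_gt0// addr_gt0.
have D2 : 0 < r ^+ 2 + (a - b) ^+ 2.
  rewrite lt_neqAle addr_ge0 ?sqr_ge0// andbT eq_sym paddr_eq0 ?sqr_ge0//.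
  by rewrite !sqrf_eq0 negb_and (subr_eq0 a).
have [Ia Ea] := integ_poisson t a0; have [Ib Eb] := integ_poisson' s b0.
have [Iq Eq] := integ_sum_cpoisson s t a0 b0.
(* The two conjugate kernels get the same coefficient [C] in the partial fractions, so only their
   integrable sum of integral 0 occurs. *)
have lin A B C : \int[mu]_u (A * poisson a (t - u) + B * poisson b (u - s) +
      C * (cpoisson a (t - u) + cpoisson b (u - s))) = (A + B) * pi.
  have IA := integZ A Ia; have IB := integZ B Ib; have IC := integZ C Iq.
  rewrite (RintD (integD IA IB) IC) (RintD IA IB).
  by rewrite (RintZ A Ia) (RintZ B Ib) (RintZ C Iq) Ea Eb Eq mulr0 addr0 mulrDl.
have xr u : t - u = r - (u - s) by rewrite /r; ring.
have dx u : (r - (u - s)) ^+ 2 + a ^+ 2 != 0 by rewrite gt_eqF ?den_gt0.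
have dw u : (u - s) ^+ 2 + b ^+ 2 != 0 by rewrite gt_eqF ?den_gt0.
have nD1 := lt0r_neq0 D1; have nD2 := lt0r_neq0 D2.
pose P := poisson (a + b) r; pose Q := cpoisson (a + b) r.
(* Here [a - b] may be negative or zero: these are only rational coefficients, well defined by [D2],
   and they cancel in the sum [A + B]. *)
pose P' := poisson (a - b) r; pose Q' := cpoisson (a - b) r.
split.
- transitivity (\int[mu]_u ((- (P + P') / 2) * poisson a (t - u) +
    ((P' - P) / 2) * poisson b (u - s) +
    ((Q + Q') / 2) * (cpoisson a (t - u) + cpoisson b (u - s)))).
    apply: eq_Rintegral => u _; rewrite xr /P /P' /Q /Q' /poisson /cpoisson.
    by field; rewrite nD1 nD2 dx dw.
  by rewrite lin -/P; field.
- transitivity (\int[mu]_u (((Q + Q') / 2) * poisson a (t - u) +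
    ((Q - Q') / 2) * poisson b (u - s) +
    ((P + P') / 2) * (cpoisson a (t - u) + cpoisson b (u - s)))).
    apply: eq_Rintegral => u _; rewrite xr /P /P' /Q /Q' /poisson /cpoisson.
    by field; rewrite nD1 nD2 dx dw.
  by rewrite lin -/Q; field.
Qed.

Lemma conv_kernels a b s t : 0 < a -> 0 < b ->
  \int[mu]_u (cpoisson a (t - u) * cpoisson b (u - s)) = - pi * poisson (a + b) (t - s) /\
  \int[mu]_u (poisson a (t - u) * cpoisson b (u - s)) = pi * cpoisson (a + b) (t - s).
Proof.
move=> a0 b0.
have [nd|] := boolP ((t - s != 0) || (a != b)).
  exact: conv_kernels_nondegenerate.
rewrite negb_or !negbK => /andP[/eqP ts /eqP ab]; subst b.
(* In the degenerate case the second scale is moved up to [c n] and then let down to [a]; as [c n]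
   exceeds [a], [cpoisson a] is a majorant. *)
pose c n : R := a + harmonic n.
have h0 n : 0 < harmonic n :> R by rewrite invr_gt0.
have c0 n : 0 < c n by rewrite addr_gt0.
have ca : c n @[n --> \oo] --> a.
  rewrite -[X in _ --> X]addr0; apply: cvgD; first exact: cvg_cst.
  exact: cvg_harmonic.
have H n : _ := @conv_kernels_nondegenerate a (c n) s t a0 (c0 n) _.
have nd n : (t - s != 0) || (a != c n).
  by rewrite ts eqxx/= -subr_eq0 /c opprD addNKr oppr_eq0 gt_eqF.
have {}H := H nd.
have cq u : cpoisson (c n) u @[n --> \oo] --> cpoisson a u.
  apply: cvgM; first exact: cvg_cst.
  apply: cvgV; first by rewrite gt_eqF// den_gt0.
  by apply: cvgD; [exact: cvg_cst|rewrite !expr2; exact: cvgM].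
have cca : a + c n @[n --> \oo] --> a + a.
  by apply: cvgD; [exact: cvg_cst|].
have dca : (t - s) ^+ 2 + (a + c n) ^+ 2 @[n --> \oo] --> (t - s) ^+ 2 + (a + a) ^+ 2.
  by apply: cvgD; [exact: cvg_cst|rewrite expr2; exact: cvgM].
have aa0 : 0 < a + a by rewrite addr_gt0.
have ms (f : R -> R) : continuous f -> measurable_fun [set: R] (fun u : R => f (t - u)).
  by move=> cf; apply: continuous_measurable_fun; exact: shift_cont.
have ms' (f : R -> R) : continuous f -> measurable_fun [set: R] (fun u : R => f (u - s)).
  move=> cf; apply: continuous_measurable_fun => u.
  apply: (@continuous_comp _ _ _ (fun v => v - s) f); last exact: cf.
  by apply: cvgB; [exact: cvg_id|exact: cvg_cst].
have dom (k : R -> R) : continuous k -> (forall u, k u ^+ 2 <= a^-1 * poisson a u) ->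
    \int[mu]_u (k (t - u) * cpoisson (c n) (u - s)) @[n --> \oo] -->
    \int[mu]_u (k (t - u) * cpoisson a (u - s)).
  move=> ck kle.
  have mk n : measurable_fun [set: R] (fun u => k (t - u) * cpoisson (c n) (u - s)).
    by apply: measurable_funM; [exact: ms|exact: ms' (cpoisson_cont (c0 n))].
  apply: (@real_dct _ _ _ mu _ _
    (fun u => a^-1 * (poisson a (t - u) + poisson a (u - s))) mk _ _ _ _).2.
  - by apply: measurable_funM; [exact: ms|exact: ms' (cpoisson_cont a0)].
  - by move=> u; apply: cvgM; [exact: cvg_cst|exact: cq].
  - exact: (integZ a^-1 (integD (integ_poisson t a0).1 (integ_poisson' s a0).1)).
  - move=> n u; rewrite normrM.
    have h1 : `|cpoisson (c n) (u - s)| <= `|cpoisson a (u - s)|.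
      by apply: cpoisson_anti => //; rewrite /c lerDl ltW.
    apply: (le_trans (ler_wpM2l (normr_ge0 _) h1)).
    have h2 := kle (t - u); have h3 := cpoisson_sqr_le (u - s) a0.
    rewrite mulrDr; apply: le_trans (lerD h2 h3).
    by rewrite -normrM norm_mul_le.
split.
- have h := dom _ (cpoisson_cont a0) (fun u => cpoisson_sqr_le u a0).
  move: h; under eq_fun do rewrite (H _).1.
  move=> h; apply: (cvg_unique (@Rhausdorff R) h).
  apply: cvgM; first exact: cvg_cst.
  apply: cvgM => //; apply: cvgV => //; rewrite gt_eqF// den_gt0//.
- have h := dom _ (poisson_cont a0) (fun u => poisson_sqr_le u a0).
  move: h; under eq_fun do rewrite (H _).2.
  move=> h; apply: (cvg_unique (@Rhausdorff R) h).
  apply: cvgM; first exact: cvg_cst.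
  apply: cvgM; first exact: cvg_cst.
  by apply: cvgV => //; rewrite gt_eqF// den_gt0//.
Qed.

End kernels.

(** * Square-integrable functions *)

Section square_integrable.
Context d (T : measurableType d) (R : realType)
  (m : {measure set T -> \bar R}).
Implicit Types f g : T -> R.

Definition sqint f := measurable_fun [set: T] f /\ integ m (fun t => f t ^+ 2).

Lemma sqint_mul f g : sqint f -> sqint g -> integ m (fun t => f t * g t).
Proof.
move=> [mf f2] [mg g2]; apply: (integ_le _ (integD f2 g2)).
  exact: measurable_funM.
by move=> t; exact: norm_mul_le.
Qed.

Lemma Rint_mul_le f g : sqint f -> sqint g ->
  \int[m]_t `|f t * g t| <= \int[m]_t (f t ^+ 2) + \int[m]_t (g t ^+ 2).
Proof.
move=> sf sg; rewrite -(RintD sf.2 sg.2); apply: Rint_le.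
- exact: integ_norm (sqint_mul sf sg).
- exact: integD sf.2 sg.2.
- by move=> t; exact: norm_mul_le.
Qed.

Lemma sqintD f g : sqint f -> sqint g -> sqint (fun t => f t + g t).
Proof.
move=> sf sg; split; first exact: measurable_funD sf.1 sg.1.
have e t : (f t + g t) ^+ 2 = f t ^+ 2 + (2 * (f t * g t) + g t ^+ 2) by ring.
under eq_fun do rewrite e.
exact: integD sf.2 (integD (integZ 2 (sqint_mul sf sg)) sg.2).
Qed.

Lemma sqintZ (c : R) f : sqint f -> sqint (fun t => c * f t).
Proof.
move=> sf; split; first exact: measurable_funM (measurable_cst _) sf.1.
under eq_fun do rewrite exprMn.
exact: integZ sf.2.
Qed.

End square_integrable.

(** * Convolution with dominated kernels, and the Poisson form *)

Section convolution.
Context (R : realType).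
Local Notation mu := (@lebesgue_measure R).
Local Notation mu2 := (mu \x mu)%E.
Implicit Types (f g k : R -> R) (a b s t u y e C : R).

(** The property shared by all three kernels: their translates have L^2 norms bounded independently
    of the point, so convolution with a square-integrable function converges absolutely at every
    point. *)
Definition kernel_bound k C a :=
  [/\ 0 < a, measurable_fun [set: R] k & forall u, k u ^+ 2 <= C * poisson a u].

Lemma kernel_bound_poisson a : 0 < a -> kernel_bound (poisson a) a^-1 a.
Proof. by move=> a0; split => // [|u]; [exact: poisson_meas|exact: poisson_sqr_le]. Qed.

Lemma kernel_bound_cpoisson a : 0 < a -> kernel_bound (cpoisson a) a^-1 a.
Proof. by move=> a0; split => // [|u]; [exact: cpoisson_meas|exact: cpoisson_sqr_le]. Qed.

Lemma kernel_bound_hkernel e : 0 < e -> kernel_bound (hkernel e) (4 / e) e.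
Proof.
move=> e0; split => // [|u]; first exact: hkernel_meas.
have h1 := cpoisson_sqr_le u e0; have h2 := poisson_sqr_le u e0.
have h3 := cpoisson_hkernel_le u e0.
have : (cpoisson e u - hkernel e u) ^+ 2 <= poisson e u ^+ 2.
  rewrite -(real_normK (num_real (_ - _))) ler_pXn2r// nnegrE//.
  exact: le_trans h3.
move: (poisson e u) (cpoisson e u) (hkernel e u) h1 h2 => p q k h1 h2 h4.
(* This square gives k^2 <= 2 q^2 + 2 (q - k)^2, where q^2 and (q - k)^2 are each at most p / e:
   hence the constant 4 / e. *)
have := sqr_ge0 (q + (q - k)); nra.
Qed.

Lemma measurable_shift k t : measurable_fun [set: R] k ->
  measurable_fun [set: R] (fun s => k (t - s)).
Proof.
by move=> mk; apply: (measurableT_comp mk); exact: measurable_funB.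
Qed.

Lemma sqint_kernel k C a t : kernel_bound k C a ->
  sqint mu (fun s => k (t - s)) /\ \int[mu]_s (k (t - s) ^+ 2) <= C * pi.
Proof.
move=> [a0 mk kC]; have [Ip Ep] := integ_poisson t a0.
have ms := measurable_shift t mk.
have I : integ mu (fun s => k (t - s) ^+ 2).
  apply: (integ_le _ (integZ C Ip)); first exact: measurable_funX.
  by move=> s; rewrite ger0_norm ?sqr_ge0.
split; first by [].
by rewrite -Ep -(RintZ C Ip); apply: Rint_le => //; exact: integZ.
Qed.

Lemma sqint_cpoisson_shift c s : 0 < c -> sqint mu (fun t => cpoisson c (t - s)) /\
  \int[mu]_t (cpoisson c (t - s) ^+ 2) <= c^-1 * pi.
Proof.
move=> c0; have [[_ I1] E1] := sqint_kernel s (kernel_bound_cpoisson c0).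
have e : (fun t => cpoisson c (t - s) ^+ 2) = (fun t => cpoisson c (s - t) ^+ 2).
  by apply/funext => t; rewrite -opprB cpoissonN sqrrN.
rewrite /sqint e; split => //; split => //.
by apply: (measurableT_comp (cpoisson_meas c0)); exact: measurable_funB.
Qed.

Definition convol k f t := \int[mu]_s (k (t - s) * f s).

Lemma convol_integ k C a f t : kernel_bound k C a -> sqint mu f ->
  integ mu (fun s => k (t - s) * f s).
Proof. by move=> /sqint_kernel h sf; exact: sqint_mul (h t).1 sf. Qed.

Lemma convol_abs_le k C a f t : kernel_bound k C a -> sqint mu f ->
  \int[mu]_s `|k (t - s) * f s| <= C * pi + \int[mu]_s (f s ^+ 2).
Proof.
move=> /sqint_kernel h sf; apply: (le_trans (Rint_mul_le (h t).1 sf)).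
by rewrite lerD2r (h t).2.
Qed.

Lemma measurable_diff k : measurable_fun [set: R] k ->
  measurable_fun [set: R * R] (fun z : R * R => k (z.1 - z.2)).
Proof.
move=> mk; apply: (measurableT_comp mk).
by apply: measurable_funB; [exact: measurable_fst|exact: measurable_snd].
Qed.

Lemma measurable_1 f : measurable_fun [set: R] f ->
  measurable_fun [set: R * R] (fun z : R * R => f z.1).
Proof. by move=> mf; apply: (measurableT_comp mf); exact: measurable_fst. Qed.

Lemma measurable_2 f : measurable_fun [set: R] f ->
  measurable_fun [set: R * R] (fun z : R * R => f z.2).
Proof. by move=> mf; apply: (measurableT_comp mf); exact: measurable_snd. Qed.

Lemma measurable_convol k f : measurable_fun [set: R] k -> measurable_fun [set: R] f ->
  measurable_fun [set: R] (convol k f).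
Proof.
move=> mk mf.
have : measurable_fun [set: R * R] (fun z : R * R => k (z.1 - z.2) * f z.2).
  by apply: measurable_funM; [exact: measurable_diff|exact: measurable_2].
by move=> /(@measurable_Rint _ _ _ _ _ mu).
Qed.

Lemma integ_poisson_1 g a : 0 < a -> integ mu g ->
  integ mu2 (fun z => g z.1 * poisson a (z.1 - z.2)).
Proof.
move=> a0 Ig; have mg := integ_meas Ig.
apply: (prod_integ _ _ (integZ pi (integ_norm Ig))).
- by apply: measurable_funM; [exact: measurable_1|exact: measurable_diff (poisson_meas a0)].
- by move=> x /=; exact: integZ (integ_poisson x a0).1.
- move=> x /=; under eq_Rintegral do
    rewrite normrM (gtr0_norm (poisson_gt0 _ a0)).
  by rewrite (RintZ _ (integ_poisson x a0).1) (integ_poisson x a0).2 mulrC.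
Qed.

Lemma integ_poisson_2 g a : 0 < a -> integ mu g ->
  integ mu2 (fun z => g z.2 * poisson a (z.1 - z.2)).
Proof.
move=> a0 Ig; have mg := integ_meas Ig.
apply: (prod_integ2 _ _ (integZ pi (integ_norm Ig))).
- by apply: measurable_funM; [exact: measurable_2|exact: measurable_diff (poisson_meas a0)].
- by move=> x /=; exact: integZ (integ_poisson' x a0).1.
- move=> x /=; under eq_Rintegral do
    rewrite normrM (gtr0_norm (poisson_gt0 _ a0)).
  by rewrite (RintZ _ (integ_poisson' x a0).1) (integ_poisson' x a0).2 mulrC.
Qed.

Definition pform f y := \int[mu2]_z (f z.1 * f z.2 * poisson y (z.1 - z.2)).

(** A majorant for the integrand of [pform], through |f(t) f(s)| <= f(t)^2 + f(s)^2. Each summand is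
    integrable because the Poisson kernel has mass pi in either variable. *)
Lemma pform_dom f a : 0 < a -> sqint mu f ->
  integ mu2 (fun z => f z.1 ^+ 2 * poisson a (z.1 - z.2) +
    f z.2 ^+ 2 * poisson a (z.1 - z.2)).
Proof.
move=> a0 [mf f2]; exact: integD (integ_poisson_1 a0 f2) (integ_poisson_2 a0 f2).
Qed.

Lemma measurable_pform f a : 0 < a -> measurable_fun [set: R] f ->
  measurable_fun [set: R * R] (fun z => f z.1 * f z.2 * poisson a (z.1 - z.2)).
Proof.
move=> a0 mf; apply: measurable_funM; last exact: measurable_diff (poisson_meas a0).
by apply: measurable_funM; [exact: measurable_1|exact: measurable_2].
Qed.

Lemma pform_integ f a : 0 < a -> sqint mu f ->
  integ mu2 (fun z => f z.1 * f z.2 * poisson a (z.1 - z.2)).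
Proof.
move=> a0 sf; apply: (integ_le _ (pform_dom a0 sf)).
  exact: measurable_pform sf.1.
move=> z; rewrite normrM (gtr0_norm (poisson_gt0 _ a0)) -mulrDl.
rewrite ler_wpM2r ?(ltW (poisson_gt0 _ a0))//.
exact: norm_mul_le.
Qed.

End convolution.

(** * Integrals of tensor products *)

Section product_integral.
Context d1 d2 (T1 : measurableType d1) (T2 : measurableType d2) (R : realType).
Variables (m1 : {sigma_finite_measure set T1 -> \bar R})
  (m2 : {sigma_finite_measure set T2 -> \bar R}).

Lemma integ_tensor (g : T1 -> R) (h : T2 -> R) : integ m1 g -> integ m2 h ->
  integ (m1 \x m2)%E (fun z => g z.1 * h z.2) /\
  \int[(m1 \x m2)%E]_z (g z.1 * h z.2) = (\int[m1]_x g x) * (\int[m2]_y h y).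
Proof.
move=> Ig Ih.
have mF : measurable_fun [set: T1 * T2] (fun z : T1 * T2 => g z.1 * h z.2).
  apply: measurable_funM.
  - by apply: (measurableT_comp (integ_meas Ig)); exact: measurable_fst.
  - by apply: (measurableT_comp (integ_meas Ih)); exact: measurable_snd.
have I : integ (m1 \x m2)%E (fun z => g z.1 * h z.2).
  apply: (prod_integ mF _ (integZ (\int[m2]_y `|h y|) (integ_norm Ig))).
  - by move=> x /=; exact: integZ.
  - move=> x /=; under eq_Rintegral do rewrite normrM.
    by rewrite (RintZ _ (integ_norm Ih)) mulrC.
split => //; rewrite -(fubini1 I).2 /=.
under eq_Rintegral do rewrite (RintZ _ Ih) mulrC.
by rewrite (RintZ _ Ig) mulrC.
Qed.

End product_integral.

(** * The quadratic identity for integrable signals *)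

Section quadratic_identity.
Context (R : realType).
Local Notation mu := (@lebesgue_measure R).
Local Notation mR := (measurableTypeR R).
Local Notation mu2 := (mu \x mu)%E.
Implicit Types (f g k : R -> R) (a b s t u y : R).

(** Expanding both convolutions gives a triple integral, in which [t] is integrated first by
    [conv_kernels]. Integrability of [f] makes f(s) f(s') integrable on the plane, while the
    integral of the kernels in [t] is bounded uniformly in s and s'. *)
Lemma Rint_cpoisson_conv f a b : integ mu f -> sqint mu f -> 0 < a -> 0 < b ->
  integ mu (fun t => convol (cpoisson a) f t * convol (cpoisson b) f t) /\
  \int[mu]_t (convol (cpoisson a) f t * convol (cpoisson b) f t) = pi * pform f (a + b).
Proof.
move=> If sf a0 b0; have mf := sf.1.
pose F (z : mR * (mR * mR)) :=
  (cpoisson a (z.1 - z.2.1) * f z.2.1) * (cpoisson b (z.1 - z.2.2) * f z.2.2).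
have kqa := kernel_bound_cpoisson a0; have kqb := kernel_bound_cpoisson b0.
have m21 : measurable_fun [set: mR * (mR * mR)] (fun z : mR * (mR * mR) => z.2.1).
  by apply: (measurableT_comp measurable_fst); exact: measurable_snd.
have m22 : measurable_fun [set: mR * (mR * mR)] (fun z : mR * (mR * mR) => z.2.2).
  by apply: (measurableT_comp measurable_snd); exact: measurable_snd.
have mF : measurable_fun [set: mR * (mR * mR)] F.
  apply: measurable_funM; apply: measurable_funM.
  - apply: (measurableT_comp (cpoisson_meas a0)).
    by apply: measurable_funB => //; exact: measurable_fst.
  - exact: measurableT_comp mf m21.
  - apply: (measurableT_comp (cpoisson_meas b0)).
    by apply: measurable_funB => //; exact: measurable_fst.
  - exact: measurableT_comp mf m22.
have inner (w : mR * mR) : integ mu (fun t => cpoisson a (t - w.1) * cpoisson b (t - w.2)).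
  exact: sqint_mul (sqint_cpoisson_shift _ a0).1 (sqint_cpoisson_shift _ b0).1.
have FE t (w : mR * mR) : F (t, w) =
    (f w.1 * f w.2) * (cpoisson a (t - w.1) * cpoisson b (t - w.2)).
  by rewrite /F /=; ring.
have [Iff _] := integ_tensor If If.
have H1 w : integ mu (fun t => F (t, w)).
  by under eq_fun do rewrite FE; exact: integZ.
have H2 w : \int[mu]_t `|F (t, w)| <= (a^-1 * pi + b^-1 * pi) * `|f w.1 * f w.2|.
  under eq_Rintegral do rewrite FE normrM.
  rewrite (RintZ _ (integ_norm (inner w))) mulrC ler_wpM2r//.
  apply: (le_trans (Rint_mul_le (sqint_cpoisson_shift _ a0).1 (sqint_cpoisson_shift _ b0).1)).
  exact: lerD (sqint_cpoisson_shift _ a0).2 (sqint_cpoisson_shift _ b0).2.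
(* The pair of signal variables is treated as one variable, which reduces the triple integral to the
   two-variable Fubini theorem. *)
have IF := prod_integ2 (m1 := mu) (m2 := sigma_finite_prod mu mu) mF H1
  (integZ (a^-1 * pi + b^-1 * pi) (integ_norm Iff)) H2.
have e1 t : convol (cpoisson a) f t * convol (cpoisson b) f t =
    \int[sigma_finite_prod mu mu]_w F (t, w).
  exact: (esym (integ_tensor (convol_integ t kqa sf) (convol_integ t kqb sf)).2).
have e1' : (fun t => convol (cpoisson a) f t * convol (cpoisson b) f t) =
    (fun t => \int[sigma_finite_prod mu mu]_w F (t, w)) by apply/funext.
split; first by rewrite e1'; exact: (fubini1 IF).1.
rewrite e1'; apply: (etrans (fubini1 IF).2).
apply: (etrans (esym (fubini2 IF))); rewrite /pform.
rewrite -(RintZ pi (pform_integ (addr_gt0 a0 b0) sf)).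
apply: eq_Rintegral => w _.
under eq_Rintegral do rewrite FE.
rewrite (RintZ _ (inner w)).
have [E2 _] := conv_kernels w.2 w.1 a0 b0.
(* Oddness turns the correlation into a convolution; the sign it costs cancels the one in -pi
   p_(a+b). *)
have -> : \int[mu]_t (cpoisson a (t - w.1) * cpoisson b (t - w.2)) =
    - \int[mu]_t (cpoisson a (w.1 - t) * cpoisson b (t - w.2)).
  rewrite -[RHS]mulN1r -RintZ; last first.
    exact: sqint_mul (sqint_kernel w.1 kqa).1 (sqint_cpoisson_shift _ b0).1.
  by apply: eq_Rintegral => t _; rewrite -(opprB w.1) cpoissonN; ring.
by rewrite E2; ring.
Qed.

(** Exchanging the two variables negates the odd kernel, so Fubini shows the integral equal to its
    opposite. *)
Lemma Rint_cpoisson_skew f a : integ mu f -> sqint mu f -> 0 < a ->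
  integ mu (fun t => f t * convol (cpoisson a) f t) /\
  \int[mu]_t (f t * convol (cpoisson a) f t) = 0.
Proof.
move=> If sf a0.
pose F (z : mR * mR) := f z.1 * f z.2 * cpoisson a (z.1 - z.2).
have mF : measurable_fun [set: mR * mR] F.
  apply: measurable_funM; last exact: measurable_diff (cpoisson_meas a0).
  by apply: measurable_funM; [exact: measurable_1 sf.1|exact: measurable_2 sf.1].
have IF : integ mu2 F.
  apply: (integ_le mF (integZ a^-1 (integ_norm (integ_tensor If If).1))).
  by move=> z; rewrite normrM mulrC ler_wpM2r// cpoisson_le.
have e1 : (fun t => f t * convol (cpoisson a) f t) = (fun t => \int[mu]_s F (t, s)).
  apply/funext => t; rewrite /convol -(RintZ _ (convol_integ t (kernel_bound_cpoisson a0) sf)).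
  by apply: eq_Rintegral => s _; rewrite /F /=; ring.
have I : integ mu (fun t => f t * convol (cpoisson a) f t).
  by rewrite e1; exact: (fubini1 IF).1.
have e2 : (fun s => \int[mu]_t F (t, s)) = (fun s => -1 * (f s * convol (cpoisson a) f s)).
  apply/funext => s.
  have Is := convol_integ s (kernel_bound_cpoisson a0) sf.
  rewrite /convol -(RintZ _ Is) -(RintZ _ (integZ _ Is)).
  by apply: eq_Rintegral => t _; rewrite /F /= -(opprB s) cpoissonN; ring.
split => //.
have E1 : \int[mu]_t (f t * convol (cpoisson a) f t) = \int[mu2]_z F z.
  by rewrite e1; exact: (fubini1 IF).2.
have E2 : -1 * \int[mu]_t (f t * convol (cpoisson a) f t) = \int[mu2]_z F z.
  by rewrite -(RintZ _ I) -e2; exact: fubini2 IF.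
by move: E2; rewrite -E1; set J := (\int[mu]_t _); lra.
Qed.

(** The cross terms with [f] vanish by [Rint_cpoisson_skew]. Two scales and three coefficients are
    kept so that the Cauchy estimate and the bound on the limit are both instances. *)
Lemma quadratic_identity f a b (l x y : R) : integ mu f -> sqint mu f ->
  0 < a -> 0 < b ->
  integ mu (fun t => (l * f t + x * convol (cpoisson a) f t + y * convol (cpoisson b) f t) ^+ 2) /\
  \int[mu]_t ((l * f t + x * convol (cpoisson a) f t + y * convol (cpoisson b) f t) ^+ 2) =
  l ^+ 2 * \int[mu]_t (f t ^+ 2) + pi * (x ^+ 2 * pform f (a + a) +
    2 * x * y * pform f (a + b) + y ^+ 2 * pform f (b + b)).
Proof.
move=> If sf a0 b0.
have [Ia Ea] := Rint_cpoisson_skew If sf a0; have [Ib Eb] := Rint_cpoisson_skew If sf b0.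
have [Iaa Eaa] := Rint_cpoisson_conv If sf a0 a0.
have [Iab Eab] := Rint_cpoisson_conv If sf a0 b0.
have [Ibb Ebb] := Rint_cpoisson_conv If sf b0 b0.
pose G t := l ^+ 2 * f t ^+ 2 + 2 * l * x * (f t * convol (cpoisson a) f t) +
   2 * l * y * (f t * convol (cpoisson b) f t) +
   x ^+ 2 * (convol (cpoisson a) f t * convol (cpoisson a) f t) +
   2 * x * y * (convol (cpoisson a) f t * convol (cpoisson b) f t) +
   y ^+ 2 * (convol (cpoisson b) f t * convol (cpoisson b) f t).
have -> : (fun t => (l * f t + x * convol (cpoisson a) f t + y * convol (cpoisson b) f t) ^+ 2) = G.
  by apply/funext => t; rewrite /G; ring.
have i1 := integZ (l ^+ 2) sf.2.
have i2 := integD i1 (integZ (2 * l * x) Ia).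
have i3 := integD i2 (integZ (2 * l * y) Ib).
have i4 := integD i3 (integZ (x ^+ 2) Iaa).
have i5 := integD i4 (integZ (2 * x * y) Iab).
have i6 := integD i5 (integZ (y ^+ 2) Ibb).
split; first exact: i6.
rewrite (RintD i5 (integZ (y ^+ 2) Ibb)) (RintD i4 (integZ (2 * x * y) Iab)).
rewrite (RintD i3 (integZ (x ^+ 2) Iaa)) (RintD i2 (integZ (2 * l * y) Ib)).
rewrite (RintD i1 (integZ (2 * l * x) Ia)).
rewrite (RintZ _ sf.2) (RintZ _ Ia) (RintZ _ Ib) (RintZ _ Iaa) (RintZ _ Iab).
rewrite (RintZ _ Ibb) Ea Eb Eaa Eab Ebb.
by ring.
Qed.

End quadratic_identity.

(** * Poisson means at a Lebesgue point *)

Section lebesgue_points.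
Context (R : realType).
Local Notation mu := (@lebesgue_measure R).
Implicit Types (f g : R -> R) (t s u y r e : R).

Definition ind_ball r u : R := if `|u| < r then 1 else 0.

Lemma ind_ball_ge0 r u : 0 <= ind_ball r u.
Proof. by rewrite /ind_ball; case: ifP. Qed.

(** On |u| < r the denominator u^2 + r^2 is at most 2 r^2. *)
Lemma ind_ball_le r u : 0 < r -> ind_ball r u <= 2 * r * poisson r u.
Proof.
move=> r0; have p0 := poisson_gt0 u r0; rewrite /ind_ball; case: ifPn => [ur|_]; last first.
  by rewrite mulr_ge0 ?(ltW p0)// mulr_ge0// ltW.
rewrite /poisson mulrA ler_pdivlMr ?den_gt0// mul1r.
have : u ^+ 2 <= r ^+ 2.
  by rewrite -(real_normK (num_real u)) ler_pXn2r ?nnegrE ?(ltW r0)// ltW.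
move=> h; rewrite [leRHS](_ : _ = r ^+ 2 + r ^+ 2); last by ring.
by rewrite lerD2r.
Qed.

Lemma measurable_ind_ball r t : measurable_fun [set: R] (fun s => ind_ball r (t - s)).
Proof.
apply: measurable_fun_ifT => //; apply: measurable_fun_ltr => //.
by apply: measurableT_comp => //; exact: measurable_funB.
Qed.

Lemma integ_ind_ball r t : 0 < r -> integ mu (fun s => ind_ball r (t - s)) /\
  \int[mu]_s ind_ball r (t - s) <= 2 * r * pi.
Proof.
move=> r0; have [Ip Ep] := integ_poisson t r0.
have I : integ mu (fun s => ind_ball r (t - s)).
  apply: (integ_le _ (integZ (2 * r) Ip)); first exact: measurable_ind_ball.
  by move=> s; rewrite ger0_norm ?ind_ball_ge0// ind_ball_le.
split => //; rewrite -Ep -(RintZ _ Ip); apply: Rint_le => //; first exact: integZ.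
by move=> s; exact: ind_ball_le.
Qed.

Section at_point.
Variables (f : R -> R) (t : R).
Hypothesis sf : sqint mu f.
Let g (s : R) : R := `|f s - f t|.
Let G (r : R) : R := \int[mu]_s (g s * ind_ball r (t - s)).

Let g_ge0 s : 0 <= g s. Proof. exact: normr_ge0. Qed.

Let g_meas : measurable_fun [set: R] g.
Proof.
by apply: measurableT_comp => //; apply: measurable_funB => //; exact: sf.1.
Qed.

Let g_le s : g s <= f s ^+ 2 + (1 + `|f t|).
Proof.
rewrite /g (le_trans (ler_normB _ _))// addrA lerD2r.
rewrite ler_norml; apply/andP; split; nra.
Qed.

Let gb_meas r : measurable_fun [set: R] (fun s => g s * ind_ball r (t - s)).
Proof. by apply: measurable_funM => //; exact: measurable_ind_ball. Qed.

(** A crude bound at every radius, from |f(s) - f(t)| <= f(s)^2 + 1 + |f(t)|. It controls the large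
    radii, about which the Lebesgue point says nothing. *)
Let G_bound r : 0 < r ->
  integ mu (fun s => g s * ind_ball r (t - s)) /\
  G r <= \int[mu]_s (f s ^+ 2) + (1 + `|f t|) * (2 * r * pi).
Proof.
move=> r0; have [Ib Eb] := integ_ind_ball t r0.
have D := integD sf.2 (integZ (1 + `|f t|) Ib).
have le s : g s * ind_ball r (t - s) <=
    f s ^+ 2 + (1 + `|f t|) * ind_ball r (t - s).
  have := g_le s; have := sqr_ge0 (f s).
  by rewrite /ind_ball; case: ifP => _; rewrite ?mulr1 ?mulr0// addr0.
have I : integ mu (fun s => g s * ind_ball r (t - s)).
  apply: (integ_le _ D); first exact: gb_meas.
  by move=> s; rewrite ger0_norm// mulr_ge0// ind_ball_ge0.
split => //; apply: (le_trans (Rint_le I D le)).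
rewrite (RintD sf.2 (integZ _ Ib)) (RintZ _ Ib) lerD2l.
by rewrite ler_wpM2l// addr_ge0.
Qed.

Let G_small e : lebesgue_pt f t -> 0 < e ->
  exists2 d, 0 < d & forall r, 0 < r -> r < d -> G r <= e * r.
Proof.
move=> lp e0.
(* The ball has length 2 r, so an average below e / 2 means an integral below e r. *)
have e2 : 0 < e / 2 by rewrite divr_gt0.
have : \forall r \near 0^'+, (davg f t r < (e / 2)%:E)%E.
  move: lp => /fine_cvgP[fin /cvgr_lt/(_ (e / 2) e2)].
  by apply: filterS2 fin => r h1 h2; rewrite -(fineK h1) lte_fin.
move=> [d /= d0 dP]; exists d => // r r0 rd.
have := dP r; rewrite /= sub0r normrN gtr0_norm// => /(_ rd r0).
rewrite /davg /iavg lebesgue_measure_ball ?(ltW r0)// inver mulrn_eq0/= gt_eqF//.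
have -> : (\int[mu]_(y in ball t r) `|((center (f t) \o f) y)%:E| = (G r)%:E)%E.
  rewrite /G (EFin_Rint (G_bound r0).1) [LHS]integral_mkcond; apply: eq_integral => s _.
  have e1 : ((s : R) \in (ball t r : set R)) = (`|t - s| < r) by apply/idP/idP; rewrite inE.
  by rewrite patchE e1 /ind_ball; case: ifP; rewrite ?mulr1 ?mulr0//= normr_id.
rewrite -EFinM lte_fin -ltr_pdivlMl ?invr_gt0 ?mulrn_wgt0// invrK => /ltW.
by move/le_trans; apply; rewrite -mulr_natl le_eqVlt; apply/orP; left; apply/eqP; field.
Qed.

(** Outside the ball of radius 4^n y the kernel is at most y / (4^n y)^2, which is the weight 16 / y
    times 16^-(n+1) of the next ball. Radii grow by 4 while weights fall by 16, so bounds linear in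
    the radius become summable. *)
Let poisson_dyadic_le y n : 0 < y ->
  forall s, poisson y (t - s) * g s * ind_ball (4 ^+ n * y) (t - s) <=
  \sum_(k < n.+1) (16 / y * 16 ^- k * (g s * ind_ball (4 ^+ k * y) (t - s))).
Proof.
move=> y0 s.
have t0 k : 0 <= 16 / y * 16 ^- k * (g s * ind_ball (4 ^+ k * y) (t - s)).
  by rewrite !mulr_ge0 ?ind_ball_ge0// ?invr_ge0 ?exprn_ge0// ltW.
have p0 := ltW (poisson_gt0 (t - s) y0).
elim: n => [|n IH].
  rewrite big_ord_recl big_ord0 addr0 expr0 mul1r invr1 mulr1 -mulrA.
  rewrite ler_wpM2r ?mulr_ge0 ?ind_ball_ge0//.
  by apply: (le_trans (poisson_le _ y0)); rewrite ler_peMl ?invr_ge0 ?(ltW y0)// ler1n.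
have [ts|ts] := boolP (`|t - s| < 4 ^+ n * y).
  rewrite big_ord_recr/=; apply: (le_trans _ (lerD IH (t0 n.+1))).
  rewrite addr0 /ind_ball ts (lt_le_trans ts)//.
  by rewrite ler_pM2r// ler_eXn2l// ltr1n.
rewrite big_ord_recr/= -[leLHS]add0r; apply: lerD; first exact: sumr_ge0.
rewrite -mulrA ler_wpM2r ?mulr_ge0 ?ind_ball_ge0//.
move: ts; rewrite -leNgt => ts.
rewrite /poisson ler_pdivrMr ?den_gt0//.
have h : (4 ^+ n * y) ^+ 2 <= (t - s) ^+ 2.
  rewrite -(real_normK (num_real (t - s))) ler_pXn2r ?nnegrE//.
  by rewrite mulr_ge0 ?(ltW y0)// exprn_ge0.
have c0 : 0 < 16 / y * 16 ^- n.+1 :> R.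
  by rewrite mulr_gt0 ?divr_gt0// invr_gt0 exprn_gt0.
apply: (@le_trans _ _ (16 / y * 16 ^- n.+1 * (4 ^+ n * y) ^+ 2)); last first.
  rewrite ler_wpM2l ?(ltW c0)// (le_trans h)// lerDl sqr_ge0//.
rewrite le_eqVlt; apply/orP; left; apply/eqP.
rewrite exprMn -exprM mulnC exprM exprS.
have -> : 4 ^+ 2 = 16 :> R by rewrite -natrX.
by field; rewrite expf_neq0 ?pnatr_eq0// gt_eqF.
Qed.

Lemma poisson_lebesgue_pt : lebesgue_pt f t -> forall e, 0 < e ->
  exists2 d, 0 < d & forall y, 0 < y -> y < d ->
    integ mu (fun s => poisson y (t - s) * `|f s - f t|) /\
    \int[mu]_s (poisson y (t - s) * `|f s - f t|) <= e.
Proof.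
move=> lp e e0.
have e'0 : 0 < e / 64 by rewrite divr_gt0.
have [d d0 Gd] := G_small lp e'0.
(* Chosen so that G r <= C r once r >= d: the f^2 term is absorbed through 1 <= r / d, and the last
   1 keeps [C] positive. *)
pose C := (\int[mu]_s (f s ^+ 2)) / d + (1 + `|f t|) * (2 * pi) + 1.
have S0 : 0 <= \int[mu]_s (f s ^+ 2) by apply: Rintegral_ge0 => s _; exact: sqr_ge0.
have C0 : 0 < C.
  rewrite /C ltr_wpDl// addr_ge0 ?divr_ge0 ?(ltW d0)//.
  by rewrite mulr_ge0 ?addr_ge0// mulr_ge0// pi_ge0.
have GC r : d <= r -> G r <= C * r.
  move=> dr; have r0 := lt_le_trans d0 dr.
  apply: (le_trans (G_bound r0).2); rewrite /C.
  have : \int[mu]_s (f s ^+ 2) <= (\int[mu]_s (f s ^+ 2)) / d * r.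
    by rewrite -mulrA ler_peMr// ler_pdivlMl// mulr1.
  move: (\int[mu]_s (f s ^+ 2)) (_ / d) => I J IJ.
  by rewrite !mulrDl mul1r -[leLHS]addr0; nra.
(* For the far balls, r >= d together with y < d v^2 forces q < v, and then 16 C q^2 <= (e / 4)
   q. *)
pose v := e / (64 * C).
have v0 : 0 < v by rewrite divr_gt0// mulr_gt0.
exists (d * v ^+ 2); first by rewrite mulr_gt0// exprn_gt0.
move=> y y0 yd.
(* With q = 2^-k the radius is q^-2 y and the weight 16 q^4 / y. Near balls contribute at most (e /
   4) q^2 and far ones at most (e / 4) q; the common bound (e / 2) 2^-k sums to e. *)
have term (k : nat) : 16 / y * 16 ^- k * G (4 ^+ k * y) <= e / 2 * 2 ^- k.
  pose q : R := 2 ^- k.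
  have q0 : 0 < q by rewrite invr_gt0 exprn_gt0.
  have q1 : q <= 1 by rewrite invf_le1 ?exprn_gt0// exprn_ege1// ler1n.
  have E4 : 4 ^+ k = q ^- 2 :> R.
    have -> : 4 = 2 ^+ 2 :> R by rewrite -natrX.
    by rewrite -exprM mulnC exprM /q; field; rewrite expf_neq0.
  have E16 : 16 ^- k = q ^+ 4 :> R.
    have -> : 16 = 2 ^+ 4 :> R by rewrite -natrX.
    by rewrite -exprM mulnC exprM /q; field; rewrite expf_neq0.
  rewrite E4 E16 -/q; set r := q ^- 2 * y.
  have r0 : 0 < r by rewrite mulr_gt0// invr_gt0 exprn_gt0.
  have c0 : 0 <= 16 / y * q ^+ 4 by rewrite mulr_ge0 ?divr_ge0 ?exprn_ge0// ltW.
  have qn : q != 0 by rewrite gt_eqF.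
  have yn : y != 0 by rewrite gt_eqF.
  have [rd|rd] := ltP r d.
    apply: (le_trans (ler_wpM2l c0 (Gd _ r0 rd))).
    rewrite [leLHS](_ : _ = e / 4 * q ^+ 2); last first.
      by rewrite /r; field; rewrite qn yn.
    have : e * q ^+ 2 <= e * q by rewrite ler_pM2l// expr2 ler_piMr// ltW.
    have : 0 < e * q by rewrite mulr_gt0.
    by rewrite [e / 4 * _]mulrAC [e / 2 * _]mulrAC; move: (e * q) (e * q ^+ 2) => *; lra.
  apply: (le_trans (ler_wpM2l c0 (GC _ rd))).
  rewrite [leLHS](_ : _ = 16 * C * q ^+ 2); last first.
    by rewrite /r; field; rewrite qn yn.
  have qv : q < v.
    have : d < q ^- 2 * (d * v ^+ 2).
      by rewrite (le_lt_trans rd)// /r ltr_pM2l// invr_gt0 exprn_gt0.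
    rewrite ltr_pdivlMl ?exprn_gt0// mulrC ltr_pM2l// ltr_pXn2r// nnegrE ltW//.
  have : C * q ^+ 2 <= C * (q * v).
    by rewrite ler_pM2l// expr2 ler_pM2l// ltW.
  rewrite (_ : C * (q * v) = e / 64 * q); last by rewrite /v; field; rewrite gt_eqF.
  have : 0 < e * q by rewrite mulr_gt0.
  move=> h1 h2; rewrite -mulrA; move: h1 h2.
  rewrite [e / 64 * _]mulrAC [e / 2 * _]mulrAC.
  by move: (e * q) (C * q ^+ 2) => *; lra.
(* The cut-off to the ball where the dyadic bound applies; Fatou removes it and supplies
   integrability. *)
pose h n s := poisson y (t - s) * g s * ind_ball (4 ^+ n * y) (t - s).
have r_gt0 n : 0 < 4 ^+ n * y by rewrite mulr_gt0// exprn_gt0.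
have h_ge0 n s : 0 <= h n s.
  apply: mulr_ge0; last exact: ind_ball_ge0.
  by apply: mulr_ge0 => //; apply/ltW/poisson_gt0.
have mpg : measurable_fun [set: R] (fun s => poisson y (t - s) * g s).
  by apply: measurable_funM => //; apply: measurable_shift; exact: poisson_meas.
have Ih n : integ mu (h n).
  apply: (integ_le _ (integZ y^-1 (G_bound (r_gt0 n)).1)).
    by apply: measurable_funM => //; exact: measurable_ind_ball.
  move=> s; rewrite ger0_norm// /h -mulrA ler_wpM2r ?poisson_le//.
  by rewrite mulr_ge0 ?ind_ball_ge0.
have sum_le n : integ mu (fun s => \sum_(k < n)
     (16 / y * 16 ^- k * (g s * ind_ball (4 ^+ k * y) (t - s)))) /\
   \int[mu]_s (\sum_(k < n)
     (16 / y * 16 ^- k * (g s * ind_ball (4 ^+ k * y) (t - s)))) <=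
     e * (1 - 2 ^- n).
  elim: n => [|n [In En]].
    under eq_fun do rewrite big_ord0.
    split; first exact: integrable0.
    by rewrite Rintegral_cst// mul0r expr0 invr1 subrr mulr0.
  under eq_fun do rewrite big_ord_recr/=.
  have IG := (G_bound (r_gt0 n)).1.
  split; first exact: integD In (integZ _ IG).
  rewrite (RintD In (integZ _ IG)) (RintZ _ IG).
  apply: (le_trans (lerD En (term n))).
  rewrite le_eqVlt; apply/orP; left; apply/eqP.
  by rewrite exprS; field; rewrite expf_neq0.
apply: (@real_fatou _ _ _ mu h (fun s => poisson y (t - s) * g s) (cst e) e Ih h_ge0).
- exact: mpg.
- apply: nearW => s; apply: cvg_near_cst; near=> n.
  rewrite /h /ind_ball ifT ?mulr1// -ltr_pdivrMr//.
  apply: (@le_lt_trans _ _ n%:R); first by near: n; exact: nbhs_infty_ger.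
  by rewrite -natrX ltr_nat ltn_expl.
- move=> n; apply: (le_trans (Rint_le (Ih n) (sum_le n.+1).1 (poisson_dyadic_le n y0))).
  apply: (le_trans (sum_le n.+1).2); apply: ler_piMr; first exact: ltW.
  by rewrite gerBl invr_ge0 exprn_ge0.
- exact: cvg_cst.
Unshelve. all: by end_near. Qed.

End at_point.

End lebesgue_points.

(** * Poisson means and the Poisson form as the scale tends to 0 *)

Section poisson_limit.
Context (R : realType).
Local Notation mu := (@lebesgue_measure R).
Local Notation mR := (measurableTypeR R).
Local Notation mu2 := (mu \x mu)%E.
Implicit Types (f g : R -> R) (t s u y r e : R).

Lemma sqint_locally_integrable f : sqint mu f -> locally_integrable setT f.
Proof.
move=> sf; split; [exact: sf.1|exact: openT|] => K _ cK.
have [M [_ MK]] := compact_bounded cK.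
(* The indicator of a segment containing [K], on which |f| <= f^2 + 1. *)
have I1 := integ_trunc_continuous (Num.truncn (M + 1)).+1 (fun u => @cst_continuous R R 1 u).
have /integrableP[mD D] := integD sf.2 I1.
apply: le_lt_trans D.
have mK : measurable (K : set mR) by exact: compact_measurable.
rewrite [leLHS]integral_mkcond; apply: ge0_le_integral => //.
- by move=> s _; rewrite patchE; case: ifP.
- apply/(measurable_restrictT _ mK).
  apply: measurable_funTS; apply/measurable_EFinP.
  by apply: measurableT_comp => //; exact: sf.1.
- exact: measurableT_comp.
- move=> s _; rewrite patchE; case: ifPn => [Ks|_]; last exact: abse_ge0.
  move: Ks; rewrite inE => Ks.
  rewrite /= lee_fin.
  have sM : `|s| <= M + 1 by apply: MK => //; rewrite ltrDl.
  rewrite /trunc ifT; last by rewrite (le_trans sM)// ltW// truncnS_gt.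
  rewrite [leRHS]ger0_norm ?addr_ge0 ?sqr_ge0//.
  by rewrite /cst ler_norml; apply/andP; split; nra.
Qed.

Lemma ae_poisson f : sqint mu f -> {ae mu, forall t, forall e, 0 < e ->
  exists2 d, 0 < d & forall y, 0 < y -> y < d ->
    integ mu (fun s => poisson y (t - s) * `|f s - f t|) /\
    \int[mu]_s (poisson y (t - s) * `|f s - f t|) <= e}.
Proof.
move=> sf; have := lebesgue_differentiation (sqint_locally_integrable sf).
by apply: ae_impl => t lt; exact: poisson_lebesgue_pt.
Qed.

Lemma convol_poisson_sub f t y : 0 < y -> sqint mu f ->
  integ mu (fun s => poisson y (t - s) * `|f s - f t|) ->
  `|convol (poisson y) f t - pi * f t| <= \int[mu]_s (poisson y (t - s) * `|f s - f t|).
Proof.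
move=> y0 sf I; have [Ip Ep] := integ_poisson t y0.
have Ic := convol_integ t (kernel_bound_poisson y0) sf.
rewrite -Ep /convol (mulrC _ (f t)) -mulNr -(RintZ _ Ip) -(RintD Ic (integZ _ Ip)).
apply: (le_trans (Rint_norm (integD Ic (integZ _ Ip)))).
apply: Rint_le => //; first exact: integ_norm (integD Ic (integZ _ Ip)).
move=> s; rewrite mulNr (mulrC (f t)) -mulrBr normrM gtr0_norm//.
exact: poisson_gt0.
Qed.

Lemma ae_convol_poisson_cvg f (y_ : nat -> R) : sqint mu f -> (forall n, 0 < y_ n) ->
  y_ n @[n --> \oo] --> 0 ->
  {ae mu, forall t, convol (poisson (y_ n)) f t @[n --> \oo] --> pi * f t}.
Proof.
move=> sf y0 yl; have := ae_poisson sf; apply: ae_impl => t ht.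
apply/cvgrPdist_le => e e0; have [d d0 dP] := ht _ e0.
move: yl => /cvgr_lt/(_ d d0) nd.
near=> n; rewrite distrC.
have yd : y_ n < d by near: n; exact: nd.
have [I E] := dP _ (y0 n) yd.
exact: le_trans (convol_poisson_sub (y0 n) sf I) E.
Unshelve. all: by end_near. Qed.

(** Nonnegativity of a variance: (f(s) - m)^2 is integrated against the kernel, with [m] the mean of
    [f] for the kernel divided by its mass pi. *)
Lemma convol_poisson_sqr_le f t y : 0 < y -> sqint mu f ->
  integ mu (fun s => f s ^+ 2 * poisson y (t - s)) /\
  convol (poisson y) f t ^+ 2 <= pi * \int[mu]_s (f s ^+ 2 * poisson y (t - s)).
Proof.
move=> y0 sf; have [Ip Ep] := integ_poisson t y0.
have Ic := convol_integ t (kernel_bound_poisson y0) sf.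
have I2 : integ mu (fun s => f s ^+ 2 * poisson y (t - s)).
  apply: (integ_le _ (integZ y^-1 sf.2)).
    apply: measurable_funM; last by apply: measurable_shift; exact: poisson_meas.
    by apply: measurable_funX; exact: sf.1.
  move=> s; rewrite (ger0_norm (mulr_ge0 (sqr_ge0 _) (ltW (poisson_gt0 _ y0)))).
  by rewrite mulrC ler_wpM2r ?sqr_ge0// poisson_le.
split => //.
set A := \int[mu]_s _; set B := convol _ _ _.
pose m := B / pi.
have Iall := integD I2 (integD (integZ (- (2 * m)) Ic) (integZ (m ^+ 2) Ip)).
have : 0 <= \int[mu]_s (f s ^+ 2 * poisson y (t - s) +
   (- (2 * m) * (poisson y (t - s) * f s) + m ^+ 2 * poisson y (t - s))).
  apply: Rintegral_ge0 => s _.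
  rewrite [leRHS](_ : _ = (f s - m) ^+ 2 * poisson y (t - s)); last by ring.
  exact: (mulr_ge0 (sqr_ge0 _) (ltW (poisson_gt0 _ y0))).
rewrite (RintD I2 (integD (integZ _ Ic) (integZ _ Ip))).
rewrite (RintD (integZ _ Ic) (integZ _ Ip)) (RintZ _ Ic) (RintZ _ Ip) Ep -/A.
rewrite -[\int[mu]_s _]/B.
have p0 : 0 < pi :> R by exact: pi_gt0.
rewrite [X in 0 <= X](_ : _ = (pi * A - B ^+ 2) / pi); last first.
  by rewrite /m; move: (@pi R) p0 => P P0; field; exact: lt0r_neq0.
by rewrite pmulr_lge0 ?invr_gt0// subr_ge0.
Qed.

(* Jensen for the probability [poisson y (t - _) / pi], applied to [f + f t]. *)
Lemma poisson_sqr f y : 0 < y -> sqint mu f ->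
  integ mu (fun t => (convol (poisson y) f t + pi * f t) ^+ 2) /\
  \int[mu]_t ((convol (poisson y) f t + pi * f t) ^+ 2) <=
    2 * pi * (pform f y + pi * \int[mu]_t (f t ^+ 2)).
Proof.
move=> y0 sf.
pose A t := \int[mu]_s (f s ^+ 2 * poisson y (t - s)).
have I2 := integ_poisson_2 y0 sf.2.
have IA : integ mu A by exact: (fubini1 I2).1.
have EA : \int[mu]_t A t = pi * \int[mu]_t (f t ^+ 2).
  rewrite (etrans (fubini1 I2).2 (esym (fubini2 I2))) -(RintZ _ sf.2).
  apply: eq_Rintegral => s _ /=.
  by rewrite (RintZ _ (integ_poisson' s y0).1) (integ_poisson' s y0).2 mulrC.
have Iphi := pform_integ y0 sf.
have e1 : (fun t => f t * convol (poisson y) f t) =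
    (fun t => \int[mu]_s (f t * f s * poisson y (t - s))).
  apply/funext => t; rewrite /convol -(RintZ _ (convol_integ t (kernel_bound_poisson y0) sf)).
  by apply: eq_Rintegral => s _; ring.
have IB : integ mu (fun t => f t * convol (poisson y) f t).
  by rewrite e1; exact: (fubini1 Iphi).1.
have EB : \int[mu]_t (f t * convol (poisson y) f t) = pform f y.
  by rewrite e1; exact: (fubini1 Iphi).2.
have p0 : 0 < pi :> R by exact: pi_gt0.
have D := integD IA (integD (integZ 2 IB) (integZ pi sf.2)).
have le t : (convol (poisson y) f t + pi * f t) ^+ 2 <=
    pi * (A t + (2 * (f t * convol (poisson y) f t) + pi * (f t ^+ 2))).
  have [_] := convol_poisson_sqr_le t y0 sf; rewrite -/(A t) => h.
  rewrite [leLHS](_ : _ = convol (poisson y) f t ^+ 2 +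
    pi * (2 * (f t * convol (poisson y) f t) + pi * f t ^+ 2)); last by ring.
  by rewrite [leRHS]mulrDr lerD2r.
have I : integ mu (fun t => (convol (poisson y) f t + pi * f t) ^+ 2).
  apply: (integ_le _ (integZ pi D)).
    apply: measurable_funX; apply: measurable_funD.
      exact: measurable_convol (poisson_meas y0) sf.1.
    by apply: measurable_funM => //; exact: sf.1.
  by move=> t; rewrite ger0_norm ?sqr_ge0.
split => //; apply: (le_trans (Rint_le I (integZ pi D) le)).
rewrite (RintZ _ D) (RintD IA (integD (integZ _ IB) (integZ _ sf.2))).
rewrite (RintD (integZ _ IB) (integZ _ sf.2)) (RintZ _ IB) (RintZ _ sf.2) EA EB.
by rewrite le_eqVlt; apply/orP; left; apply/eqP; ring.
Qed.

(** From 2 f(t) f(s) <= f(t)^2 + f(s)^2 and the mass pi of the kernel in each variable. *)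
Lemma pform_le f y : 0 < y -> sqint mu f -> pform f y <= pi * \int[mu]_t (f t ^+ 2).
Proof.
move=> y0 sf.
have I1 := integ_poisson_1 y0 sf.2; have I2 := integ_poisson_2 y0 sf.2.
have E1 : \int[mu2]_z (f z.1 ^+ 2 * poisson y (z.1 - z.2)) = pi * \int[mu]_t (f t ^+ 2).
  rewrite -(RintZ _ sf.2) -(fubini1 I1).2; apply: eq_Rintegral => s _ /=.
  by rewrite (RintZ _ (integ_poisson s y0).1) (integ_poisson s y0).2 mulrC.
have E2 : \int[mu2]_z (f z.2 ^+ 2 * poisson y (z.1 - z.2)) = pi * \int[mu]_t (f t ^+ 2).
  rewrite -(RintZ _ sf.2) -(fubini2 I2); apply: eq_Rintegral => s _ /=.
  by rewrite (RintZ _ (integ_poisson' s y0).1) (integ_poisson' s y0).2 mulrC.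
have D := integZ 2^-1 (integD I1 I2).
apply: (@le_trans _ _ (2^-1 * (pi * \int[mu]_t (f t ^+ 2) +
    pi * \int[mu]_t (f t ^+ 2)))); last first.
  by rewrite le_eqVlt; apply/orP; left; apply/eqP; field.
rewrite -{1}E1 -E2 -(RintD I1 I2) -(RintZ _ (integD I1 I2)).
apply: (Rint_le (pform_integ y0 sf) D) => z.
rewrite -mulrDl mulrA ler_wpM2r ?(ltW (poisson_gt0 _ y0))//.
by have := sqr_ge0 (f z.1 - f z.2); nra.
Qed.

(* Otherwise Fatou along scales with [pform f y <= pi |f|^2 - e] would contradict
   the almost everywhere convergence of [convol (poisson y) f] to [pi f]. *)
Lemma pform_near f e : sqint mu f -> 0 < e ->
  exists2 d, 0 < d & forall y, 0 < y -> y < d ->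
    pi * \int[mu]_t (f t ^+ 2) - e < pform f y.
Proof.
move=> sf e0; apply: contrapT => H.
have p0 : 0 < pi :> R by exact: pi_gt0.
set S := \int[mu]_t (f t ^+ 2) in H *.
have /choice[y_ Hy] : forall n : nat, exists y, [/\ 0 < y, y < harmonic n &
    pform f y <= pi * S - e].
  move=> n; apply: contrapT => Hn; apply: H; exists (harmonic n).
    by rewrite invr_gt0.
  by move=> y y0 yn; rewrite ltNge; apply/negP => h; apply: Hn; exists y.
have y0 n : 0 < y_ n by have [] := Hy n.
have yl : y_ n @[n --> \oo] --> 0.
  apply: (@squeeze_cvgr _ _ _ _ (cst 0) (@harmonic R)).
  - by apply: nearW => n; have [h1 h2 _] := Hy n; rewrite (ltW h1) (ltW h2).
  - exact: cvg_cst.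
  - exact: cvg_harmonic.
(* The limit has integral (2 pi)^2 S, while the bound along the bad scales is smaller by 2 pi e. *)
have [I] : integ mu (fun t => (2 * pi) ^+ 2 * f t ^+ 2) /\
    \int[mu]_t ((2 * pi) ^+ 2 * f t ^+ 2) <= 2 * pi * (2 * (pi * S) - e).
  apply: (@real_fatou _ _ _ mu
    (fun n t => (convol (poisson (y_ n)) f t + pi * f t) ^+ 2) _
    (cst (2 * pi * (2 * (pi * S) - e)))).
  - by move=> n; exact: (poisson_sqr (y0 n) sf).1.
  - by move=> n t; exact: sqr_ge0.
  - exact: integ_meas (integZ _ sf.2).
  - have := ae_convol_poisson_cvg sf y0 yl; apply: ae_impl => t ct.
    have c2 : convol (poisson (y_ n)) f t + pi * f t @[n --> \oo] --> pi * f t + pi * f t.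
      by apply: cvgD => //; exact: cvg_cst.
    rewrite [X in _ --> X](_ : _ =
      (pi * f t + pi * f t) * (pi * f t + pi * f t)); last by ring.
    by rewrite /=; under eq_fun do rewrite expr2; exact: cvgM.
  - move=> n; apply: (le_trans (poisson_sqr (y0 n) sf).2).
    have [_ _ h] := Hy n.
    rewrite ler_pM2l ?mulr_gt0// -/S; lra.
  - exact: cvg_cst.
rewrite (RintZ _ sf.2) -/S => h.
have : 0 < pi * e by rewrite mulr_gt0.
by move: h; nra.
Qed.

End poisson_limit.

(** * L^2 bounds for conjugate Poisson convolutions *)

Section l2_bounds.
Context (R : realType).
Local Notation mu := (@lebesgue_measure R).
Local Notation mR := (measurableTypeR R).
Local Notation mu2 := (mu \x mu)%E.
Implicit Types (f g k : R -> R) (a b t s u y r e : R).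

Lemma integ_trunc n f : sqint mu f -> integ mu (trunc n f).
Proof.
move=> sf.
have I1 := integ_trunc_continuous n (fun u => @cst_continuous R R 1 u).
apply: (integ_le _ (integD sf.2 I1)); first exact: measurable_trunc sf.1.
move=> t; rewrite /trunc; case: ifP => _; last first.
  by rewrite normr0 addr0 sqr_ge0.
by rewrite /cst ler_norml; apply/andP; split; nra.
Qed.

Lemma trunc_sqr_le n f t : trunc n f t ^+ 2 <= f t ^+ 2.
Proof. by rewrite /trunc; case: ifP => // _; rewrite expr0n sqr_ge0. Qed.

Lemma sqint_trunc n f : sqint mu f -> sqint mu (trunc n f).
Proof.
move=> sf; split; first exact: measurable_trunc sf.1.
apply: (integ_le _ sf.2).
  by apply: measurable_funX; exact: measurable_trunc sf.1.
by move=> t; rewrite ger0_norm ?sqr_ge0// trunc_sqr_le.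
Qed.

Lemma convol_trunc_cvg k C a f t : kernel_bound k C a -> sqint mu f ->
  convol k (trunc n f) t @[n --> \oo] --> convol k f t.
Proof.
move=> kb sf.
have Ic := convol_integ t kb sf.
apply: (@real_dct _ _ _ mu _ _ (fun s => `|k (t - s) * f s|) _ _ _ _ _).2.
- by move=> n; exact: integ_meas (convol_integ t kb (sqint_trunc n sf)).
- exact: integ_meas Ic.
- by move=> s; apply: cvgM; [exact: cvg_cst|exact: trunc_cvg].
- exact: integ_norm.
- by move=> n s; rewrite !normrM ler_wpM2l// trunc_le.
Qed.

Lemma pform_trunc_cvg f y : 0 < y -> sqint mu f ->
  pform (trunc n f) y @[n --> \oo] --> pform f y.
Proof.
move=> y0 sf.
apply: (@real_dct _ _ _ mu2 _ _ _ _ _ _ (pform_dom y0 sf) _).2.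
- by move=> n; apply: (integ_meas (m := mu2)); exact: pform_integ y0 (sqint_trunc n sf).
- by apply: (integ_meas (m := mu2)); exact: pform_integ y0 sf.
- move=> z; apply: cvgM; last exact: cvg_cst.
  by apply: cvgM; exact: trunc_cvg.
- move=> n z; rewrite normrM (gtr0_norm (poisson_gt0 _ y0)) -mulrDl.
  rewrite ler_wpM2r ?(ltW (poisson_gt0 _ y0))//.
  apply: (le_trans (norm_mul_le _ _)); apply: lerD; exact: trunc_sqr_le.
Qed.

(** Obtained from [quadratic_identity] on truncations: the right-hand side converges, whereas the
    left-hand side passes to the limit by Fatou, which weakens the identity to an inequality. *)
Lemma l2_inequality f a b (l x y : R) : sqint mu f -> 0 < a -> 0 < b ->
  integ mu (fun t => (l * f t + x * convol (cpoisson a) f t + y * convol (cpoisson b) f t) ^+ 2) /\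
  \int[mu]_t ((l * f t + x * convol (cpoisson a) f t + y * convol (cpoisson b) f t) ^+ 2) <=
  l ^+ 2 * \int[mu]_t (f t ^+ 2) + pi * (x ^+ 2 * pform f (a + a) +
    2 * x * y * pform f (a + b) + y ^+ 2 * pform f (b + b)).
Proof.
move=> sf a0 b0.
have Q n := quadratic_identity l x y (integ_trunc n sf) (sqint_trunc n sf) a0 b0.
have T2 : \int[mu]_t (trunc n f t ^+ 2) @[n --> \oo] --> \int[mu]_t (f t ^+ 2).
  apply: (@real_dct _ _ _ mu _ _ (fun s => f s ^+ 2) _ _ _ _ _).2.
  - by move=> n; exact: integ_meas (sqint_trunc n sf).2.
  - exact: integ_meas sf.2.
  - move=> t; under eq_fun do rewrite expr2; rewrite expr2.
    by apply: cvgM; exact: trunc_cvg.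
  - exact: sf.2.
  - by move=> n t; rewrite ger0_norm ?sqr_ge0// trunc_sqr_le.
have mcv c : 0 < c -> measurable_fun [set: R] (convol (cpoisson c) f).
  by move=> c0; exact: measurable_convol (cpoisson_meas c0) sf.1.
have cst_M c (u : R -> R) : measurable_fun [set: R] u ->
  measurable_fun [set: R] (fun t => c * u t) by exact: measurable_funM.
apply: (@real_fatou _ _ _ mu (fun n t => (l * trunc n f t +
    x * convol (cpoisson a) (trunc n f) t + y * convol (cpoisson b) (trunc n f) t) ^+ 2) _
  (fun n => l ^+ 2 * \int[mu]_t (trunc n f t ^+ 2) +
    pi * (x ^+ 2 * pform (trunc n f) (a + a) +
    2 * x * y * pform (trunc n f) (a + b) + y ^+ 2 * pform (trunc n f) (b + b)))).
- by move=> n; exact: (Q n).1.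
- by move=> n t; exact: sqr_ge0.
- apply: measurable_funX; apply: measurable_funD; last exact: cst_M (mcv _ b0).
  apply: measurable_funD; last exact: cst_M (mcv _ a0).
  exact: cst_M sf.1.
- apply: nearW => t /=; rewrite expr2; under eq_fun do rewrite expr2.
  have c : l * trunc n f t + x * convol (cpoisson a) (trunc n f) t +
      y * convol (cpoisson b) (trunc n f) t @[n --> \oo] -->
      l * f t + x * convol (cpoisson a) f t + y * convol (cpoisson b) f t.
    apply: cvgD; first apply: cvgD.
    - by apply: cvgM; [exact: cvg_cst|exact: trunc_cvg].
    - apply: cvgM; [exact: cvg_cst|exact: convol_trunc_cvg (kernel_bound_cpoisson a0) sf].
    - apply: cvgM; [exact: cvg_cst|exact: convol_trunc_cvg (kernel_bound_cpoisson b0) sf].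
  exact: cvgM.
- by move=> n; rewrite (Q n).2.
- apply: cvgD; first by apply: cvgM; [exact: cvg_cst|].
  apply: cvgM; first exact: cvg_cst.
  apply: cvgD; first apply: cvgD; apply: cvgM;
    try exact: cvg_cst; apply: pform_trunc_cvg => //; exact: addr_gt0.
Qed.

(** The coefficients are 0, 1, -1 and the diagonal terms are bounded by [pform_le]. By [pform_near]
    the right-hand side is small for small scales, which is the Cauchy property. *)
Lemma l2_diff f a b : sqint mu f -> 0 < a -> 0 < b ->
  integ mu (fun t => (convol (cpoisson a) f t - convol (cpoisson b) f t) ^+ 2) /\
  \int[mu]_t ((convol (cpoisson a) f t - convol (cpoisson b) f t) ^+ 2) <=
    2 * pi * (pi * \int[mu]_t (f t ^+ 2) - pform f (a + b)).
Proof.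
move=> sf a0 b0.
have [] := l2_inequality 0 1 (-1) sf a0 b0.
have e t : 0 * f t + 1 * convol (cpoisson a) f t + (-1) * convol (cpoisson b) f t =
   convol (cpoisson a) f t - convol (cpoisson b) f t by ring.
under eq_fun do rewrite e; move=> I E; split => //; apply: (le_trans E).
have h1 := pform_le (addr_gt0 a0 a0) sf; have h2 := pform_le (addr_gt0 b0 b0) sf.
have p0 : 0 < pi :> R by exact: pi_gt0.
rewrite (_ : 2 * pi * _ = pi * (2 * (pi * \int[mu]_t (f t ^+ 2) - pform f (a + b)))).
  rewrite expr0n mul0r add0r ler_pM2l//; move: h1 h2.
  by set S := pi * _ => h1 h2; lra.
by ring.
Qed.

Lemma l2_comb f b (l y : R) : sqint mu f -> 0 < b ->
  integ mu (fun t => (l * f t + y * convol (cpoisson b) f t) ^+ 2) /\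
  \int[mu]_t ((l * f t + y * convol (cpoisson b) f t) ^+ 2) <=
    (l ^+ 2 + y ^+ 2 * pi ^+ 2) * \int[mu]_t (f t ^+ 2).
Proof.
move=> sf b0.
have [] := l2_inequality l 0 y sf b0 b0.
have e t : l * f t + 0 * convol (cpoisson b) f t + y * convol (cpoisson b) f t =
   l * f t + y * convol (cpoisson b) f t by ring.
under eq_fun do rewrite e; move=> I E; split => //; apply: (le_trans E).
have h2 := pform_le (addr_gt0 b0 b0) sf.
have p0 : 0 < pi :> R by exact: pi_gt0.
rewrite [leRHS]mulrDl lerD2l expr0n !mulr0 !mul0r !add0r.
rewrite (_ : y ^+ 2 * pi ^+ 2 * _ = pi * (y ^+ 2 * (pi * \int[mu]_t (f t ^+ 2)))).
  by rewrite ler_pM2l// ler_wpM2l ?sqr_ge0.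
by ring.
Qed.

Lemma sqint_convol_cpoisson f b : sqint mu f -> 0 < b -> sqint mu (convol (cpoisson b) f).
Proof.
move=> sf b0; split; first exact: measurable_convol (cpoisson_meas b0) sf.1.
have [I _] := l2_comb 0 1 sf b0.
by move: I; under eq_fun do rewrite mul0r add0r mul1r.
Qed.

(** Fubini and [conv_kernels]; the inner absolute integral is bounded uniformly, so the Poisson
    factor alone makes the double integral converge. The factor pi comes from the unnormalized
    kernels. *)
Lemma poisson_semigroup f t y b : sqint mu f -> 0 < y -> 0 < b ->
  convol (poisson y) (convol (cpoisson b) f) t = pi * convol (cpoisson (y + b)) f t.
Proof.
move=> sf y0 b0.
pose F (z : mR * mR) := poisson y (t - z.1) * (cpoisson b (z.1 - z.2) * f z.2).
have mF : measurable_fun [set: mR * mR] F.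
  apply: measurable_funM.
    apply: (@measurable_1 _ (fun u => poisson y (t - u))).
    by apply: measurable_shift; exact: poisson_meas.
  by apply: measurable_funM; [exact: measurable_diff (cpoisson_meas b0)|exact: measurable_2 sf.1].
have kb := kernel_bound_cpoisson b0.
have [Ip Ep] := integ_poisson t y0.
pose K : R := b^-1 * pi + \int[mu]_s (f s ^+ 2).
have IF : integ mu2 F.
  apply: (prod_integ mF _ (integZ K Ip)).
  - by move=> u; rewrite /F /=; exact: integZ (convol_integ u kb sf).
  - move=> u; rewrite /F /=; under eq_Rintegral do rewrite normrM.
    rewrite (RintZ _ (integ_norm (convol_integ u kb sf))) (gtr0_norm (poisson_gt0 _ y0)).
    by rewrite mulrC ler_wpM2r ?(ltW (poisson_gt0 _ y0))// (convol_abs_le u kb sf).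
have E1 : convol (poisson y) (convol (cpoisson b) f) t = \int[mu2]_z F z.
  rewrite -(fubini1 IF).2; apply: eq_Rintegral => u _.
  by rewrite -(RintZ _ (convol_integ u kb sf)).
have Iq := convol_integ t (kernel_bound_cpoisson (addr_gt0 y0 b0)) sf.
rewrite E1 -(fubini2 IF) /convol -(RintZ _ Iq); apply: eq_Rintegral => s _.
have [_ E2] := conv_kernels s t y0 b0.
rewrite mulrA -E2 mulrC -RintZ; last first.
  apply: sqint_mul; first exact: (sqint_kernel t (kernel_bound_poisson y0)).1.
  exact: (sqint_cpoisson_shift s b0).1.
by apply: eq_Rintegral => u _; rewrite /F /=; ring.
Qed.

End l2_bounds.

(** * Reflection invariance and odd kernels *)

Section odd_kernels.
Context (R : realType).
Local Notation mu := (@lebesgue_measure R).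
Local Notation mR := (measurableTypeR R).
Implicit Types (f g k : R -> R) (t s u y r e : R).

Lemma measurable_reflection (c : R) : measurable_fun [set: mR] (fun s : mR => c - s : mR).
Proof. exact: measurable_funB. Qed.

(** By uniqueness it suffices to compare half-open intervals; reflection moves the closed end to the
    other side without changing the length. *)
Lemma lebesgue_measure_reflection (c : R) (A : set mR) : measurable A ->
  pushforward mu (fun s : mR => c - s : mR) A = mu A.
Proof.
move=> mA.
pose refl : {mfun mR >-> mR} :=
  HB.pack (fun s : mR => c - s : mR)
    (isMeasurableFun.Build _ _ _ _ _ (measurable_reflection c)).
apply/esym/(@lebesgue_measure_unique R (pushforward mu refl)) => //= _ [[a b]] _ <-.
have E : refl @^-1` [set` `]a, b]] = [set` `[c - b, c - a[].
  apply/seteqP; split=> s /=; rewrite !in_itv/= => /andP[h1 h2];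
    apply/andP; split; lra.
rewrite /pushforward E !lebesgue_measure_itv/= !lte_fin.
rewrite ltrD2l ltrN2; case: ifP => // _.
by rewrite -!EFinB; congr (_%:E); ring.
Qed.

Lemma Rint_odd k t : (forall u, k (- u) = - k u) ->
  integ mu (fun s => k (t - s)) -> \int[mu]_s k (t - s) = 0.
Proof.
move=> kN I.
pose f (s : mR) : R := k (t - s).
pose refl (s : mR) : mR := t + t - s.
have frefl s : f (refl s) = - f s.
  by rewrite /f /refl -kN; congr k; ring.
have I2 : integ mu (fun s => f (refl s)).
  under eq_fun do rewrite frefl -mulN1r.
  exact: integZ.
have mE : measurable_fun [set: mR] (EFin \o f) by exact: (measurable_int _ I).
have E : \int[mu]_s f s = \int[mu]_s f (refl s).
  rewrite /Rintegral; congr fine.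
  rewrite -(@integral_pushforward _ _ _ _ _ refl (measurable_reflection (t + t))
    mu setT (EFin \o f) mE)//.
  apply: eq_measure_integral; first exact: measurable_reflection.
  by move=> mphi A mA _ /=; rewrite -(lebesgue_measure_reflection (t + t) mA).
move: E; under [X in _ = X -> _]eq_Rintegral do rewrite frefl -mulN1r.
rewrite (RintZ _ I) /f; set J := (\int[mu]_s _); lra.
Qed.

(** The difference [k] of the kernels has integral 0, so f(s) may be replaced by f(s) - f(t) before
    taking absolute values. *)
Lemma convol_hkernel_cpoisson_sub f t e : 0 < e -> sqint mu f ->
  integ mu (fun s => poisson e (t - s) * `|f s - f t|) ->
  `|convol (hkernel e) f t - convol (cpoisson e) f t| <=
    \int[mu]_s (poisson e (t - s) * `|f s - f t|).
Proof.
move=> e0 sf I; have [Ip _] := integ_poisson t e0.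
pose k u := hkernel e u - cpoisson e u.
have mk : measurable_fun [set: R] k.
  by apply: measurable_funB; [exact: hkernel_meas|exact: cpoisson_meas].
have kle u : `|k u| <= poisson e u by rewrite /k distrC cpoisson_hkernel_le.
have Ik : integ mu (fun s => k (t - s)).
  by apply: (integ_le _ Ip) => //; exact: measurable_shift.
have J : \int[mu]_s k (t - s) = 0.
  by apply: Rint_odd => // u; rewrite /k hkernelN cpoissonN opprD.
have Ikk := convol_integ t (kernel_bound_hkernel e0) sf.
have Iq := convol_integ t (kernel_bound_cpoisson e0) sf.
have D := integD (integD Ikk (integZ (-1) Iq)) (integZ (- f t) Ik).
have -> : convol (hkernel e) f t - convol (cpoisson e) f t = \int[mu]_s
    (hkernel e (t - s) * f s + -1 * (cpoisson e (t - s) * f s) + - f t * k (t - s)).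
  rewrite (RintD (integD Ikk (integZ (-1) Iq)) (integZ (- f t) Ik)).
  by rewrite (RintD Ikk (integZ (-1) Iq)) !RintZ// J mulr0 addr0 mulN1r.
apply: (le_trans (Rint_norm D)); apply: Rint_le => //; first exact: integ_norm D.
move=> s; rewrite [X in `|X|](_ : _ = k (t - s) * (f s - f t)); last first.
  by rewrite /k; ring.
by rewrite normrM ler_wpM2r.
Qed.

End odd_kernels.

(** * The limit of the conjugate Poisson convolutions *)

Section hilbert_limit.
Context (R : realType).
Local Notation mu := (@lebesgue_measure R).
Local Notation mR := (measurableTypeR R).
Implicit Types (f g k : R -> R) (t s u y r e : R).

(** The increments are at most sqrt(M) 2^-n, a summable sequence. *)
Lemma cvg_summable_increments (u : nat -> R) (M : R) :
  (forall n, 4 ^+ n * (u n.+1 - u n) ^+ 2 <= M) -> cvgn u.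
Proof.
move=> uM.
have M0 : 0 <= M by apply: le_trans (uM 0%N); rewrite expr0 mul1r sqr_ge0.
have h n : `|telescope u n| <= geometric (Num.sqrt M) 2^-1 n.
  rewrite /telescope/= -(@ler_pXn2r _ 2)// ?nnegrE ?mulr_ge0 ?exprn_ge0 ?sqrtr_ge0//.
  rewrite exprMn sqr_sqrtr// real_normK ?num_real// -exprM mulnC exprM.
  have -> : (2^-1 : R) ^+ 2 = 4^-1 by rewrite exprVn -natrX.
  by rewrite exprVn mulrC ler_pdivlMl ?exprn_gt0.
have c : cvgn (series (telescope u)).
  apply: (@normed_cvg _ R); apply: series_le_cvg h _ => //.
  - by move=> n; rewrite /geometric/= mulr_ge0 ?sqrtr_ge0 ?exprn_ge0.
  - apply: is_cvg_geometric_series.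
    by rewrite ger0_norm// invf_lt1// ltr1n.
rewrite (_ : u = (fun n => u 0%N + series (telescope u) n)); last first.
  by apply/funext => n; exact: eq_sum_telescope.
by apply: is_cvgD => //; exact: is_cvg_cst.
Qed.

(** The rate 16^-j leaves the summable 4^-j after [ae_cvg_fast] inserts the weight 4^j. Uniformity
    in all later [k] gives in addition a rate for the L^2 distance to the limit. *)
Lemma fast_scales f : sqint mu f -> exists y_ : nat -> R,
  [/\ forall n, 0 < y_ n, y_ n @[n --> \oo] --> 0 &
   forall j (k : nat), (j <= k)%N ->
     \int[mu]_t ((convol (cpoisson (y_ j)) f t - convol (cpoisson (y_ k)) f t) ^+ 2) <=
       2 * pi * 16 ^- j].
Proof.
move=> sf; set S := \int[mu]_t (f t ^+ 2).
have /choice[d Hd] : forall n : nat, exists d, [/\ 0 < d, d <= harmonic n &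
    forall y, 0 < y -> y < d -> pi * S - 16 ^- n < pform f y].
  move=> n; have e0 : 0 < 16 ^- n :> R by rewrite invr_gt0 exprn_gt0.
  have [d d0 dP] := pform_near sf e0.
  exists (Num.min d (harmonic n)); split.
  - by rewrite lt_min d0 invr_gt0 ltr0Sn.
  - by rewrite ge_min lexx orbT.
  - by move=> y y0; rewrite lt_min => /andP[yd _]; exact: dP.
(* The scale [P n / 4] is below the thresholds [d j] of all earlier [j]. *)
pose P n := \prod_(j < n.+1) d j.
have d0 n : 0 < d n by have [] := Hd n.
have d1 n : d n <= 1.
  have [_ h _] := Hd n; apply: (le_trans h).
  by rewrite invf_le1 ?ltr0Sn// ler1n.
have P0 n : 0 < P n by apply: prodr_gt0.
have Pd n : P n <= d n.
  rewrite /P big_ord_recr/= ler_piMl ?(ltW (d0 _))//.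
  by apply: prodr_ile1 => i _; rewrite (ltW (d0 _)) d1.
have Pm j (k : nat) : (j <= k)%N -> P k <= P j.
  elim: k => [|k IH]; first by rewrite leqn0 => /eqP ->.
  rewrite leq_eqVlt => /predU1P[->//|/IH]; apply: le_trans.
  by rewrite /P [leLHS]big_ord_recr/= ler_piMr// ltW// P0.
exists (fun n => P n / 4); split.
- by move=> n; rewrite divr_gt0.
- apply: (@squeeze_cvgr _ _ _ _ (cst 0) (@harmonic R)).
  + apply: nearW => n; rewrite (ltW (divr_gt0 _ _))//=.
    have [_ h _] := Hd n; apply: le_trans h; apply: le_trans (Pd n).
    by rewrite ler_pdivrMr// ler_peMr ?(ltW (P0 n))// ler1n.
  + exact: cvg_cst.
  + exact: cvg_harmonic.
- move=> j k jk.
  have pj : 0 < P j / 4 by rewrite divr_gt0.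
  have P'k : 0 < P k / 4 by rewrite divr_gt0.
  apply: (le_trans (l2_diff sf pj P'k).2).
  rewrite ler_pM2l ?mulr_gt0 ?pi_gt0// -/S.
  have [_ _ h] := Hd j; apply/ltW; rewrite ltrBlDr -ltrBlDl; apply: h.
    exact: addr_gt0.
  (* The division by 4 serves here: P j / 4 + P k / 4 <= P j / 2 < d j. *)
  have := Pm _ _ jk; have := Pd j; have := P0 j; lra.
Qed.

(** The series [W] of the weighted squared increments has finite integral, so it is finite almost
    everywhere; there it bounds each of its terms and [cvg_summable_increments] applies. *)
Lemma ae_cvg_fast (u : nat -> R -> R) (C : R) :
  (forall n, sqint mu (u n)) ->
  (forall n, \int[mu]_t ((u n t - u n.+1 t) ^+ 2) <= C * 16 ^- n) ->
  exists2 h, measurable_fun [set: mR] h &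
    {ae mu, forall t, u n t @[n --> \oo] --> (h t : R)}.
Proof.
move=> su uC.
(* The limsup is measurable on the whole line and agrees with the limit wherever the sequence
   converges. *)
pose h t := fine (limn_esup (fun n => (u n t)%:E)).
exists h.
  apply: measurableT_comp => //; apply: measurable_fun_limn_esup => n.
  by apply/measurable_EFinP; exact: (su n).1.
pose w n t := 4 ^+ n * (u n t - u n.+1 t) ^+ 2.
have Iw n : integ mu (w n).
  apply: integZ; have := (sqintD (su n) (sqintZ (-1) (su n.+1))).2.
  by under eq_fun do rewrite mulN1r.
have w0 n t : 0 <= w n t by rewrite mulr_ge0 ?sqr_ge0// exprn_ge0.
have C0 : 0 <= C.
  have := uC 0%N; rewrite expr0 invr1 mulr1; apply: le_trans.
  by apply: Rintegral_ge0 => t _; exact: sqr_ge0.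
have wC n : \int[mu]_t w n t <= C * 4 ^- n.
  rewrite /w RintZ; last first.
    have := (sqintD (su n) (sqintZ (-1) (su n.+1))).2.
    by under eq_fun do rewrite mulN1r.
  have := uC n; rewrite -(ler_pM2l (exprn_gt0 n (ltr0Sn R 3))) => /le_trans; apply.
  have -> : 16 = 4 * 4 :> R by ring.
  rewrite exprMn le_eqVlt; apply/orP; left; apply/eqP.
  by field; rewrite expf_neq0.
pose W t := (\sum_(n <oo) (w n t)%:E)%E.
have mW : measurable_fun [set: mR] W.
  apply: ge0_emeasurable_sum => [n t _|n _]; first by rewrite lee_fin.
  exact: measurable_int (Iw n).
have W0 t : (0 <= W t)%E by apply: nneseries_ge0 => n _ _; rewrite lee_fin.
have IW : mu.-integrable [set: mR] W.
  apply/integrableP; split => //.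
  under eq_integral do rewrite (gee0_abs (W0 _)).
  rewrite integral_nneseries//; first last.
  - by move=> n t _; rewrite lee_fin.
  - by move=> n; exact: measurable_int (Iw n).
  apply: (@le_lt_trans _ _ (2 * C)%:E); last exact: ltry.
  apply: lime_le.
    by apply: is_cvg_nneseries => n _ _; apply: integral_ge0 => t _; rewrite lee_fin.
  apply: nearW => n.
  have : (\sum_(0 <= i < n) \int[mu]_t (w i t)%:E <= (2 * C * (1 - 4 ^- n))%:E)%E.
    elim: n => [|n IH]; first by rewrite big_nil expr0 invr1 subrr mulr0.
    rewrite big_nat_recr//=; have wn : (\int[mu]_t (w n t)%:E <= (C * 4 ^- n)%:E)%E.
      by rewrite -EFin_Rint// lee_fin.
    apply: (le_trans (leeD IH wn)).
    rewrite -EFinD lee_fin exprS invfM.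
    have : 0 < 4 ^- n :> R by rewrite invr_gt0 exprn_gt0.
    move: (4 ^- n) => q q0.
    rewrite -subr_ge0 [leRHS](_ : _ = C * q / 2); last by field.
    by rewrite divr_ge0// mulr_ge0// ltW.
  move=> /le_trans; apply; rewrite lee_fin.
  apply: ler_piMr; first by rewrite mulr_ge0.
  by rewrite gerBl invr_ge0 exprn_ge0.
have := integrable_ae measurableT IW; apply: ae_impl => t /(_ I) Wt.
have cu : cvgn (u ^~ t).
  apply: (@cvg_summable_increments _ (fine (W t))) => n.
  rewrite -lee_fin fineK//.
  apply: (le_trans _ (@nneseries_lim_ge _ _ _ _ n.+1 _)); last first.
    by move=> i _ _; rewrite lee_fin.
  rewrite big_nat_recr//= /w -sqrrN opprB leeDr// sume_ge0// => i _.
  by rewrite lee_fin w0.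
have cE : (u n t)%:E @[n --> \oo] --> (limn (u^~ t))%:E by exact: cvg_EFin_comp.
by rewrite /h (cvg_limn_einf_sup cE).2; exact: cu.
Qed.

Lemma hilbert_limit f : sqint mu f -> exists h, [/\ sqint mu h,
  \int[mu]_t (f t * h t) = 0 &
  forall t y, 0 < y -> convol (poisson y) h t = pi * convol (cpoisson y) f t].
Proof.
move=> sf.
have p0 : 0 < pi :> R by exact: pi_gt0.
set S := \int[mu]_t (f t ^+ 2).
have [y_ [y0 yl yD]] := fast_scales sf.
pose u n := convol (cpoisson (y_ n)) f.
have su n : sqint mu (u n) by exact: sqint_convol_cpoisson.
have [h mh uh] := ae_cvg_fast su (fun n => yD n n.+1 (leqnSn n)).
have mlin (l y : R) : measurable_fun [set: mR] (fun t => l * f t + y * h t).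
  apply: measurable_funD; apply: measurable_funM => //; exact: sf.1.
(* Coefficients (0, 1) give square-integrability of [h], and (l, 1) for all [l] give its
   orthogonality to [f]. *)
have comb (l y : R) : integ mu (fun t => (l * f t + y * h t) ^+ 2) /\
    \int[mu]_t ((l * f t + y * h t) ^+ 2) <= (l ^+ 2 + y ^+ 2 * pi ^+ 2) * S.
  apply: (@real_fatou _ _ _ mu (fun n t => (l * f t + y * u n t) ^+ 2) _
    (cst ((l ^+ 2 + y ^+ 2 * pi ^+ 2) * S))).
  - by move=> n; exact: (l2_comb l y sf (y0 n)).1.
  - by move=> n t; exact: sqr_ge0.
  - exact: measurable_funX (mlin l y).
  - move: uh; apply: ae_impl => t ut; rewrite /= expr2; under eq_fun do rewrite expr2.
    have c : l * f t + y * u n t @[n --> \oo] --> l * f t + y * h t.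
      by apply: cvgD; [exact: cvg_cst|apply: cvgM; [exact: cvg_cst|]].
    exact: cvgM.
  - by move=> n; exact: (l2_comb l y sf (y0 n)).2.
  - exact: cvg_cst.
have sh : sqint mu h.
  split => //; have [I _] := comb 0 1; move: I.
  by under eq_fun do rewrite mul0r add0r mul1r.
have Ifh := sqint_mul sf sh.
(* Fatou in the second index of [yD] carries the rate over to the limit. *)
have Ediff n : integ mu (fun t => (u n t - h t) ^+ 2) /\
    \int[mu]_t ((u n t - h t) ^+ 2) <= 2 * pi * 16 ^- n.
  apply: (@real_fatou _ _ _ mu (fun m t => (u n t - u (m + n)%N t) ^+ 2) _
    (cst (2 * pi * 16 ^- n))).
  - by move=> m; exact: (l2_diff sf (y0 n) (y0 _)).1.
  - by move=> m t; exact: sqr_ge0.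
  - by apply: measurable_funX; apply: measurable_funB => //; exact: (su n).1.
  - move: uh; apply: ae_impl => t ut; rewrite /= expr2; under eq_fun do rewrite expr2.
    have c : u n t - u (m + n)%N t @[m --> \oo] --> u n t - h t.
      by apply: cvgB; [exact: cvg_cst|rewrite -(cvg_shiftn n) in ut].
    exact: cvgM.
  - by move=> m; apply: yD; exact: leq_addl.
  - exact: cvg_cst.
exists h; split => //.
- set J := \int[mu]_t _.
  have key l : 2 * l * J <= pi ^+ 2 * S.
    have [I E] := comb l 1.
    have e t : (l * f t + 1 * h t) ^+ 2 =
      l ^+ 2 * f t ^+ 2 + (2 * l * (f t * h t) + h t ^+ 2) by ring.
    move: E; under eq_Rintegral do rewrite e.
    rewrite (RintD (integZ _ sf.2) (integD (integZ _ Ifh) sh.2)).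
    rewrite (RintD (integZ _ Ifh) sh.2) (RintZ _ sf.2) (RintZ _ Ifh) -/S -/J.
    have : 0 <= \int[mu]_t (h t ^+ 2) by apply: Rintegral_ge0 => t _; exact: sqr_ge0.
    move: (\int[mu]_t (h t ^+ 2)) => H; rewrite expr1n mul1r mulrDl; lra.
  (* [key] bounds a linear function of [l], so its slope vanishes. *)
  have [//|J0] := eqVneq J 0.
  have := key ((pi ^+ 2 * S + 1) / (2 * J)).
  rewrite [leLHS](_ : _ = pi ^+ 2 * S + 1); last by field.
  by rewrite gerDl ler10.
- move=> t y yy0.
  have kp := kernel_bound_poisson yy0.
  have c1 : convol (poisson y) (u n) t @[n --> \oo] --> convol (poisson y) h t.
    have [sk _] := sqint_kernel t kp.
    set K := \int[mu]_s (poisson y (t - s) ^+ 2).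
    have bound n : `|convol (poisson y) h t - convol (poisson y) (u n) t| <=
        (K + 2 * pi) * 4^-1 ^+ n.
      have sd : sqint mu (fun s => h s + -1 * u n s) := sqintD sh (sqintZ (-1) (su n)).
      have Ih := convol_integ t kp sh; have Iu := convol_integ t kp (su n).
      (* Splitting the product with weights 1 / c and c before |x y| <= x^2 + y^2 balances the
         terms: K / c^2 and c^2 (2 pi) 16^-n are both of order 4^-n. *)
      pose c : R := 2 ^+ n.
      have c0 : c != 0 by rewrite expf_neq0.
      have -> : convol (poisson y) h t - convol (poisson y) (u n) t =
          \int[mu]_s ((c^-1 * poisson y (t - s)) * (c * (h s + -1 * u n s))).
        rewrite -[X in _ - X]mul1r -mulNr -(RintZ (-1) Iu) -(RintD Ih (integZ (-1) Iu)).
        by apply: eq_Rintegral => s _; field.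
      have s1 := sqintZ c^-1 sk; have s2 := sqintZ c sd.
      apply: (le_trans (Rint_norm (sqint_mul s1 s2))).
      apply: (le_trans (Rint_mul_le s1 s2)).
      under eq_Rintegral do rewrite exprMn.
      under [X in _ + X]eq_Rintegral do rewrite exprMn.
      rewrite (RintZ _ sk.2) (RintZ _ sd.2) -/K.
      have -> : \int[mu]_s ((h s + -1 * u n s) ^+ 2) = \int[mu]_s ((u n s - h s) ^+ 2).
        by apply: eq_Rintegral => s _; ring.
      have c20 : 0 <= c ^+ 2 by exact: sqr_ge0.
      apply: (le_trans (lerD (lexx _) (ler_wpM2l c20 (Ediff n).2))).
      rewrite le_eqVlt; apply/orP; left; apply/eqP.
      have E4 : 4^-1 ^+ n = c^-1 ^+ 2 :> R.
        have -> : 4 = 2 ^+ 2 :> R by rewrite -natrX.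
        by rewrite exprVn -exprM mulnC exprM exprVn.
      have E16 : 16 ^+ n = c ^+ 4 :> R.
        have -> : 16 = 2 ^+ 4 :> R by rewrite -natrX.
        by rewrite -exprM mulnC exprM.
      by rewrite E4 E16; move: (@pi R) => P; field.
    have geo : (K + 2 * pi) * 4^-1 ^+ n @[n --> \oo] --> 0.
      rewrite [X in _ --> X](_ : _ = (K + 2 * pi) * 0); last by rewrite mulr0.
      apply: cvgM; first exact: cvg_cst.
      by apply: cvg_expr; rewrite ger0_norm// invf_lt1// ltr1n.
    apply/cvgrPdist_le => e e0.
    move: geo => /cvgr_lt/(_ e e0); apply: filterS => n /ltW.
    exact: le_trans (bound n).
  have c2 : pi * convol (cpoisson (y + y_ n)) f t @[n --> \oo] -->
      pi * convol (cpoisson y) f t.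
    apply: cvgM; first exact: cvg_cst.
    have kq := kernel_bound_cpoisson yy0.
    have Iq := convol_integ t kq sf.
    have yn0 n : 0 < y + y_ n by rewrite addr_gt0.
    have cy : y + y_ n @[n --> \oo] --> y.
      by rewrite -[X in _ --> X]addr0; apply: cvgD; [exact: cvg_cst|].
    apply: (@real_dct _ _ _ mu _ _ (fun s => `|cpoisson y (t - s) * f s|) _ _ _ _ _).2.
    - by move=> n; exact: integ_meas (convol_integ t (kernel_bound_cpoisson (yn0 n)) sf).
    - exact: integ_meas Iq.
    - move=> s; apply: cvgM; last exact: cvg_cst.
      apply: cvgM; first exact: cvg_cst.
      apply: cvgV; first by rewrite gt_eqF// den_gt0.
      by apply: cvgD; [exact: cvg_cst|rewrite expr2; exact: cvgM].
    - exact: integ_norm.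
    - by move=> n s; rewrite normrM [leRHS]normrM; apply: ler_wpM2r => //; apply: cpoisson_anti => //;
        rewrite lerDl ltW.
  have e : (fun n => convol (poisson y) (u n) t) = (fun n => pi * convol (cpoisson (y + y_ n)) f t).
    by apply/funext => n; exact: poisson_semigroup.
  by rewrite e in c1; exact: (cvg_unique (@Rhausdorff R) c1 c2).
Qed.

End hilbert_limit.

(** * Convergence almost everywhere and measurability of [hilbert] *)

Section hilbert_ae.
Context (R : realType).
Local Notation mu := (@lebesgue_measure R).
Local Notation mR := (measurableTypeR R).
Implicit Types (f g k : R -> R) (t s u y r e : R).

Lemma truncated_hilbertE f e t : 0 < e -> sqint mu f ->
  truncated_hilbert e f t = pi^-1 * convol (hkernel e) f t.
Proof.
move=> e0 sf; rewrite /truncated_hilbert Rintegral_mkcond.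
rewrite -(RintZ _ (convol_integ t (kernel_bound_hkernel e0) sf)).
apply: eq_Rintegral => s _; rewrite patchE /hkernel.
have -> : (s \in [set s0 | e < `|t - s0|]) = (e < `|t - s|).
  by apply/idP/idP; rewrite inE.
case: ifP => _; last by rewrite mul0r mulr0.
by rewrite div1r invfM mulrC mulrA.
Qed.

Lemma ae_convol_hkernel_cvg f h : sqint mu f -> sqint mu h ->
  (forall t y, 0 < y -> convol (poisson y) h t = pi * convol (cpoisson y) f t) ->
  {ae mu, forall t, convol (hkernel e) f t @[e --> 0^'+] --> (h t : R)}.
Proof.
move=> sf sh hf.
have p0 : 0 < pi :> R by exact: pi_gt0.
have := ae_poisson sh; have := ae_poisson sf; apply: ae_impl2 => t ft ht.
apply/cvgrPdist_le => e e0.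
have e2 : 0 < e / 2 by rewrite divr_gt0.
have [d1 d10 D1] := ft _ e2.
have pe2 : 0 < pi * (e / 2) by rewrite mulr_gt0.
have [d2 d20 D2] := ht _ pe2.
exists (Num.min d1 d2); first by rewrite /= lt_min d10.
move=> y /=; rewrite sub0r normrN => yd y0.
rewrite gtr0_norm// lt_min in yd; case/andP: yd => yd1 yd2.
have [I1 E1] := D1 _ y0 yd1; have [I2 E2] := D2 _ y0 yd2.
have h1 := le_trans (convol_hkernel_cpoisson_sub y0 sf I1) E1.
have h2 : `|h t - convol (cpoisson y) f t| <= e / 2.
  rewrite -(ler_pM2l p0); apply: le_trans E2.
  apply: (le_trans _ (convol_poisson_sub y0 sh I2)).
  by rewrite hf// -mulrBr normrM gtr0_norm// distrC.
rewrite [X in `|X|](_ : _ = (h t - convol (cpoisson y) f t) -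
  (convol (hkernel y) f t - convol (cpoisson y) f t)).
  by rewrite [leRHS]splitr; apply: (le_trans (ler_normB _ _)); exact: lerD.
by ring.
Qed.

(** The strict inequality in [hkernel] is what gives continuity from the right: a point at distance
    exactly [e] is excluded at [e] and at every larger scale. *)
Lemma convol_hkernel_right_cvg f t e (q : nat -> R) : 0 < e -> sqint mu f ->
  (forall n, e < q n) -> q n @[n --> \oo] --> e ->
  convol (hkernel (q n)) f t @[n --> \oo] --> convol (hkernel e) f t.
Proof.
move=> e0 sf eq qe.
have q0 n : 0 < q n by exact: lt_trans (eq n).
have Ie := convol_integ t (kernel_bound_hkernel e0) sf.
apply: (@real_dct _ _ _ mu _ _ (fun s => `|hkernel e (t - s) * f s|) _ _ _ _ _).2.
- by move=> n; exact: integ_meas (convol_integ t (kernel_bound_hkernel (q0 n)) sf).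
- exact: integ_meas Ie.
- move=> s; apply: cvg_near_cst.
  have [es|es] := ltP e `|t - s|.
    move: qe => /cvgr_lt/(_ _ es); apply: filterS => n qs.
    by rewrite /hkernel es qs.
  apply: nearW => n; rewrite /hkernel (le_gtF es) (le_gtF (le_trans es _))//.
  exact: ltW.
- exact: integ_norm.
- move=> n s; rewrite normrM [leRHS]normrM; apply: ler_wpM2r => //.
  rewrite /hkernel; case: ifP => qs; last by rewrite normr0.
  by rewrite (lt_trans (eq n) qs).
Qed.

(* Right-continuity reduces the Cauchy criterion at [0^'+] to rational scales. *)
Lemma measurable_cvg_at_right (H : R -> R -> R) :
  (forall e, 0 < e -> measurable_fun [set: mR] (H e)) ->
  (forall e t (q : nat -> R), 0 < e -> (forall n, e < q n) ->
    q n @[n --> \oo] --> e -> H (q n) t @[n --> \oo] --> H e t) ->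
  measurable ([set t | cvg (H e t @[e --> 0^'+])] : set mR).
Proof.
move=> mH Hr.
(* [n] is the tolerance, [m] bounds the scales, and [p] encodes a pair of rational scales; codes of
   no admissible pair impose no condition. *)
pose E (n m p : nat) : set mR :=
  if (unpickle p : option (rat * rat)) is Some (q, q') then
    if [&& 0 < (ratr q : R), ratr q < harmonic m :> R, 0 < (ratr q' : R) &
        ratr q' < harmonic m :> R]
    then [set t | `|H (ratr q) t - H (ratr q') t| <= harmonic n] else setT
  else setT.
have mE n m p : measurable (E n m p).
  rewrite /E; case: (unpickle p) => [[q q']|]; last exact: measurableT.
  case: ifP => [/and4P[q0 _ q'0 _]|_]; last exact: measurableT.
  rewrite -[X in measurable X]setTI.
  apply: (@measurable_fun_ler _ _ _ setT
    (fun t => `|H (ratr q) t - H (ratr q') t|) (cst (harmonic n)) _ _ measurableT [set true]) => //.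
  by apply: measurableT_comp => //; apply: measurable_funB; exact: mH.
rewrite (_ : [set t | _] = \bigcap_n \bigcup_m \bigcap_p E n m p).
  apply: bigcapT_measurable => n; apply: bigcupT_measurable => m.
  by apply: bigcapT_measurable => p; exact: mE.
have h0 n : 0 < harmonic n :> R by rewrite invr_gt0 ltr0Sn.
have smallh (e : R) : 0 < e -> exists n, harmonic n < e.
  move=> e0; have /cvgr_lt/(_ e e0) := @cvg_harmonic R.
  by move=> [N _ hN]; exists N; apply: (hN N) => /=.
apply/seteqP; split => t /=.
  move=> /cvg_ex[l Hl] n _.
  have e0 : 0 < harmonic n / 2 :> R by rewrite divr_gt0.
  move: Hl => /cvgrPdist_le/(_ _ e0)[d /= d0 dP].
  have [m md] := smallh d d0.
  exists m => // p _; rewrite /E; case: (unpickle p) => [[q q']|//].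
  case: ifP => // /and4P[q0 qm q'0 q'm] /=.
  have bd x : 0 < x -> x < harmonic m -> `|l - H x t| <= harmonic n / 2.
    move=> x0 xm; apply: dP => //=.
    by rewrite sub0r normrN gtr0_norm// (lt_trans xm).
  rewrite [X in `|X|](_ : _ = (l - H (ratr q') t) - (l - H (ratr q) t)); last by ring.
  by rewrite [leRHS]splitr; apply: (le_trans (ler_normB _ _)); apply: lerD; exact: bd.
move=> Ct; apply/cauchy_cvgP/cauchy_exP => e e0.
have [n ne] := smallh e e0.
have [m _ mP] := Ct n I.
have cmp q q' : 0 < (ratr q : R) -> ratr q < harmonic m :> R -> 0 < (ratr q' : R) ->
    ratr q' < harmonic m :> R -> `|H (ratr q) t - H (ratr q') t| <= harmonic n.
  move=> q0 qm q'0 q'm; have := mP (pickle (q, q')) I.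
  by rewrite /E pickleK q0 qm q'0 q'm.
have [q' /itvP q'm] := rat_in_itvoo (h0 m).
exists (H (ratr q') t).
exists (harmonic m); first exact: h0.
move=> y /=; rewrite sub0r normrN => ym y0; rewrite gtr0_norm// in ym.
apply: le_lt_trans ne.
(* Rational scales approaching [y] from above: continuity from the right carries [cmp] over to the
   arbitrary scale [y]. *)
have /choice[q Hq] : forall j : nat, exists q : rat,
    y < ratr q :> R /\ ratr q < Num.min (harmonic m) (y + harmonic j) :> R.
  move=> j; have : y < Num.min (harmonic m) (y + harmonic j).
    by rewrite lt_min ym ltrDl h0.
  by move=> /rat_in_itvoo[q /itvP qP]; exists q; rewrite !qP.
have qm j : ratr (q j) < harmonic m :> R.
  by have [_] := Hq j; rewrite lt_min => /andP[].
have qy : (ratr (q j) : R) @[j --> \oo] --> y.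
  apply: (@squeeze_cvgr _ _ _ _ (cst y) (fun j => y + harmonic j)).
  - apply: nearW => j; have [h1] := Hq j; rewrite lt_min => /andP[_ h2].
    by rewrite /= !ltW.
  - exact: cvg_cst.
  - rewrite -[X in _ --> X]addr0; apply: cvgD; [exact: cvg_cst|exact: cvg_harmonic].
have c := Hr y t (fun j => ratr (q j)) y0 (fun j => (Hq j).1) qy.
have c' : `|H (ratr q') t - H (ratr (q j)) t| @[j --> \oo] --> `|H (ratr q') t - H y t|.
  by apply: cvg_norm; apply: cvgB => //; exact: cvg_cst.
apply: (cvgr_to_le c'); apply: nearW => j; apply: cmp => //; rewrite ?q'm//.
by rewrite (lt_trans y0)// (Hq j).1.
Qed.

(** On the Borel set [C] of convergence the transform is a limsup along the scales 1 / (n + 1); off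
    [C] it is constant. *)
Lemma measurable_hilbert f : sqint mu f -> measurable_fun [set: mR] (hilbert f).
Proof.
move=> sf.
pose H e t := pi^-1 * convol (hkernel e) f t.
pose C : set mR := [set t | cvg (H e t @[e --> 0^'+])].
have mH e : 0 < e -> measurable_fun [set: mR] (H e).
  by move=> e0; apply: measurable_funM => //; exact: measurable_convol (hkernel_meas e0) sf.1.
have mC : measurable C.
  apply: measurable_cvg_at_right => // e t q e0 eq qe.
  by apply: cvgM; [exact: cvg_cst|exact: convol_hkernel_right_cvg].
have hE t : hilbert f t = lim (H e t @[e --> 0^'+]).
  rewrite /hilbert; congr (lim _).
  have E : {near 0^'+, (fun e => truncated_hilbert e f t) =1 (fun e => H e t)}.
    by exists 1 => //= e _ e0; exact: truncated_hilbertE.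
  apply/seteqP; split; apply: near_eq_cvg => //.
  by move: E; apply: filterS => e ->.
pose h0 t := fine (limn_esup (fun n => (H (harmonic n) t)%:E)).
have mh0 : measurable_fun [set: mR] h0.
  apply: measurableT_comp => //; apply: measurable_fun_limn_esup => n.
  by apply/measurable_EFinP; apply: mH; rewrite invr_gt0 ltr0Sn.
(* The value that [lim] returns when there is no limit. *)
pose pt : R := (point : R).
rewrite (_ : hilbert f = (fun t => h0 t * \1_C t + pt * \1_(~` C) t)).
  by apply: measurable_funD; apply: measurable_funM => //;
    apply: measurable_indic => //; exact: measurableC.
apply/funext => t; rewrite hE !indicE; have [Ct|Ct] := boolP (t \in C).
  have nCt : (t \in ~` C) = false by rewrite in_setC Ct.
  rewrite nCt mulr1 mulr0 addr0.
  have cn : H (harmonic n) t @[n --> \oo] --> lim (H e t @[e --> 0^'+]).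
    have /cvg_at_rightP := set_mem Ct; apply; split; last exact: cvg_harmonic.
    by move=> n; rewrite invr_gt0 ltr0Sn.
  have cE : (H (harmonic n) t)%:E @[n --> \oo] --> (lim (H e t @[e --> 0^'+]))%:E.
    exact: cvg_EFin_comp.
  by rewrite /h0 (cvg_limn_einf_sup cE).2.
have nCt : t \in ~` C by rewrite in_setC Ct.
rewrite nCt mulr0 add0r mulr1; apply: dvgP => Ct'.
by move/negP: Ct; apply; rewrite inE.
Qed.

Lemma hilbert_transform f : sqint mu f -> exists h, [/\ sqint mu h,
  \int[mu]_t (f t * h t) = 0 &
  {ae mu, forall t, pi^-1 * convol (hkernel e) f t @[e --> 0^'+] --> (h t : R)}].
Proof.
move=> sf; have [h [sh fh hq]] := hilbert_limit sf.
exists (fun t => pi^-1 * h t); split.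
- exact: sqintZ.
- have e t : f t * (pi^-1 * h t) = pi^-1 * (f t * h t) by ring.
  under eq_Rintegral do rewrite e.
  by rewrite (RintZ _ (sqint_mul sf sh)) fh mulr0.
- have := ae_convol_hkernel_cvg sf sh hq; apply: ae_impl => t ht.
  by apply: cvgM; [exact: cvg_cst|].
Qed.

Lemma hilbert_lim f t (l : R) : sqint mu f ->
  pi^-1 * convol (hkernel e) f t @[e --> 0^'+] --> l -> hilbert f t = l.
Proof.
move=> sf cl; apply: cvg_lim => //; move: cl; apply: cvg_trans.
apply: near_eq_cvg; exists 1 => //= e _ e0.
by rewrite truncated_hilbertE.
Qed.

Lemma sqint_hilbert f h : sqint mu f -> sqint mu h ->
  {ae mu, forall t, pi^-1 * convol (hkernel e) f t @[e --> 0^'+] --> (h t : R)} ->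
  sqint mu (hilbert f).
Proof.
move=> sf sh fh; have mH := measurable_hilbert sf; split => //.
apply: (ae_Rint sh.2 _ _).1; first exact: measurable_funX.
by move: fh; apply: ae_impl => t ht; rewrite (hilbert_lim sf ht).
Qed.

End hilbert_ae.

(** * Skew-symmetry and orthogonality *)

Section skew_symmetry.
Context (R : realType).
Local Notation mu := (@lebesgue_measure R).
Implicit Types f g : R -> R.

Lemma sqint_Lfun2 f : f \in Lfun mu 2%:E -> sqint mu f.
Proof.
move=> h; split; last exact: Lfun2_integrable_sqr.
by move: h; rewrite inE => /andP[]; rewrite inE.
Qed.

(** Polarization is carried out on the limits [hf], [hg] and [h] attached to f, g and f + g, since
    [hilbert] takes default values where a limit fails to exist; [orth] translates the integrals
    back. *)
Lemma hilbert_skew f g : sqint mu f -> sqint mu g ->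
  [/\ sqint mu (hilbert f), sqint mu (hilbert g),
    \int[mu]_t (f t * hilbert f t) = 0 &
    \int[mu]_t (f t * hilbert g t + g t * hilbert f t) = 0].
Proof.
move=> sf sg.
have orth k h : sqint mu k -> sqint mu h ->
    {ae mu, forall t, pi^-1 * convol (hkernel e) k t @[e --> 0^'+] --> (h t : R)} ->
    forall v : R -> R, sqint mu v ->
    \int[mu]_t (v t * hilbert k t) = \int[mu]_t (v t * h t).
  move=> sk sh kh v sv.
  have sH := sqint_hilbert sk sh kh.
  apply: (ae_Rint (sqint_mul sv sh) (integ_meas (sqint_mul sv sH)) _).2.
  by move: kh; apply: ae_impl => t ht; rewrite (hilbert_lim sk ht).
have [hf [shf fhf cf]] := hilbert_transform sf.
have [hg [shg ghg cg]] := hilbert_transform sg.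
have sfg := sqintD sf sg.
have [h [sh fgh cfg]] := hilbert_transform sfg.
have sHf := sqint_hilbert sf shf cf; have sHg := sqint_hilbert sg shg cg.
split => //; first by rewrite (orth f hf).
(* The truncated integrals are additive in the signal, so the limits agree wherever all three
   exist. *)
have hE : {ae mu, forall t, h t = hf t + hg t}.
  have cc : {ae mu, forall t,
      pi^-1 * convol (hkernel e) (fun s => f s + g s) t @[e --> 0^'+] --> hf t + hg t}.
    move: cf cg; apply: ae_impl2 => t ft gt.
    have c : pi^-1 * convol (hkernel e) f t + pi^-1 * convol (hkernel e) g t @[e --> 0^'+] -->
      hf t + hg t by exact: cvgD.
    move: c; apply: cvg_trans; apply: near_eq_cvg.
    exists 1 => //= e _ e0; rewrite -mulrDr /convol.
    have kb := kernel_bound_hkernel e0.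
    rewrite -(RintD (convol_integ t kb sf) (convol_integ t kb sg)); congr (_ * _).
    by apply: eq_Rintegral => s _; rewrite mulrDr.
  move: cfg cc; apply: ae_impl2 => t c1 c2.
  exact: (cvg_unique (@Rhausdorff R) c1 c2).
have E : \int[mu]_t ((f t + g t) * (hf t + hg t)) = 0.
  rewrite -fgh; apply: (ae_Rint (sqint_mul sfg sh) _ _).2.
    exact: integ_meas (sqint_mul sfg (sqintD shf shg)).
  by move: hE; apply: ae_impl => t ->.
rewrite (RintD (sqint_mul sf sHg) (sqint_mul sg sHf)).
rewrite (orth g hg sg shg cg f sf) (orth f hf sf shf cf g sg).
have e t : (f t + g t) * (hf t + hg t) =
   f t * hf t + (f t * hg t + (g t * hf t + g t * hg t)) by ring.
move: E; under eq_Rintegral do rewrite e.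
have i1 := sqint_mul sf shf; have i2 := sqint_mul sf shg.
have i3 := sqint_mul sg shf; have i4 := sqint_mul sg shg.
rewrite (RintD i1 (integD i2 (integD i3 i4))) (RintD i2 (integD i3 i4)).
by rewrite (RintD i3 i4) fhf ghg add0r addr0.
Qed.

End skew_symmetry.

Theorem proposition1 (R : realType) (z o : R -> R[i])
    (hz : finite_energy z)
    (ho : forall t : R, o t =
       (hilbert (fun s => complex.Re (z s)) t)%:C
       - 'i%C * (hilbert (fun s => complex.Im (z s)) t)%:C) :
  orthogonal_signals z o.
Proof.
have [/sqint_Lfun2 sa /sqint_Lfun2 sb] := hz.
set a := (fun s => complex.Re (z s)) in sa ho.
set b := (fun s => complex.Im (z s)) in sb ho.
have [sHa sHb aHa aHb] := hilbert_skew sa sb.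
have [_ _ bHb _] := hilbert_skew sb sb.
(* Conjugating o gives Ha + i Hb, so the product is a Ha - b Hb + i (a Hb + b Ha). The two real
   terms integrate to 0 separately, the imaginary ones together by polarization. *)
have ReE : (fun t => complex.Re (z t * (o t)^*)) =
    (fun t => a t * hilbert a t + -1 * (b t * hilbert b t)).
  by apply/funext => t; rewrite ho /a /b; case: (z t) => x y /=; simpc => /=; ring.
have ImE : (fun t => complex.Im (z t * (o t)^*)) =
    (fun t => a t * hilbert b t + b t * hilbert a t).
  by apply/funext => t; rewrite ho /a /b; case: (z t) => x y /=; simpc => /=; ring.
have i1 := sqint_mul sa sHa; have i2 := sqint_mul sb sHb.
split.
  rewrite /complex_integrable ReE ImE; split.
  - exact: integD i1 (integZ (-1) i2).
  - exact: integD (sqint_mul sa sHb) (sqint_mul sb sHa).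
rewrite /complex_integral ReE ImE aHb (RintD i1 (integZ (-1) i2)) (RintZ _ i2).
by rewrite aHa bHb mulr0 addr0.
Qed.
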